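(* An element $\tilde S\in\mathcal O_{\mathrm{loc}}^2$ is a product in the operad $\mathcal O_{\mathrm{loc}}$ if and only if $S=S_0^2+\tilde S$ satisfies the Symplectic Groupoid Associativity equation.
   Context: Fix $d\ge1$. For $n\ge0$ let $B_n:=(\mathbb R^{d*})^n\times\mathbb R^d$, $B_n^0:=\{0\}\times\mathbb R^d$, $S_0^n(p_1,\dots,p_n,x):=(p_1+\dots+p_n)x$, $\mathcal O_\Delta^n:=\{S_0^n\}$. $\mathcal O_{\mathrm{loc}}^n$ is the space of germs at $B_n^0$ of smooth real functions $\tilde F$ with $\tilde F(0,x)=0$ and $\nabla_p\tilde F(0,x)=0$. $\mathcal O_\Delta+\mathcal O_{\mathrm{loc}}$ (in degree $n$: $\{S_0^n+\tilde F\}$) is a non-symmetric operad with unit $I(p,x)=px$ and composition, for $F$ of degree $n$ and $G_i$ of degree $k_i$, $$F(G_1,\dots,G_n)(p_G,x_F)=\sum_iG_i(p_{G_i},x_{G_i})+F(p_F,x_F)-x_Gp_F,$$ where $p_G=(p_{G_1},\dots,p_{G_n})$, and $p_F\in(\mathbb R^{d*})^n$, $x_G=(x_{G_1},\dots,x_{G_n})\in(\mathbb R^d)^n$ solve $p_F=(\nabla_xG_i(p_{G_i},x_{G_i}))_i$, $x_G=\nabla_pF(p_F,x_F)$ (for $p_G$ near $0$, with the solution equal to $(0,(x_F,\dots,x_F))$ at $p_G=0$). All identities are identities of germs and implicit systems are solved locally in this sense. The induced operad structure on $\mathcal O_{\mathrm{loc}}$ has unit $0\in\mathcal O_{\mathrm{loc}}^1$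 and composition $R$ defined by $(S_0^n+\tilde F)(S_0^{k_1}+\tilde G_1,\dots,S_0^{k_n}+\tilde G_n)=S_0^{k_1+\dots+k_n}+R(\tilde F;\tilde G_1,\dots,\tilde G_n)$. A product in an operad $\mathcal O$ with unit $I$ is an element $S\in\mathcal O^2$ with $S(I,S)=S(S,I)$. A generating function $S$ on (a neighborhood of $B_2^0$ in) $B_2$ satisfies the Symplectic Groupoid Associativity equation if, for $(p_1,p_2,p_3,x)\in B_3$ sufficiently close to $B_3^0$, the implicit system for $\bar x,\bar p,\tilde x,\tilde p$ $$\bar x=\nabla_{p_1}S(\bar p,p_3,x),\quad\bar p=\nabla_xS(p_1,p_2,\bar x),\quad\tilde x=\nabla_{p_2}S(p_1,\tilde p,x),\quad\tilde p=\nabla_xS(p_2,p_3,\tilde x)$$ has a unique solution and moreover $$S(p_1,p_2,\bar x)+S(\bar p,p_3,x)-\bar x\bar p=S(p_2,p_3,\tilde x)+S(p_1,\tilde p,x)-\tilde x\tilde p.$$ *)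

(* Defs.v *)
From HB Require Import structures.
From mathcomp Require Import all_boot all_order all_algebra.
From mathcomp Require Import all_classical all_reals all_analysis.

Set Implicit Arguments.
Unset Strict Implicit.
Unset Printing Implicit Defensive.

Import Order.TTheory GRing.Theory Num.Theory.
Import numFieldNormedType.Exports.

Local Open Scope classical_set_scope.
Local Open Scope ring_scope.

(* Vectors of R^d are columns and covectors are rows, so that the pairing of p
   and x is the matrix product p *m x.  An n-tuple of covectors is an n x d
   matrix (row i = i-th covector); an n-tuple of vectors is a d x n matrix
   (column i = i-th vector). *)
Definition pairing (R : realType) (d : nat) (p : 'rV[R]_d) (x : 'cV[R]_d) : R :=
  (p *m x) 0 0.

Notation B R d n := ('M[R]_(n, d) * 'cV[R]_d)%type.

Definition B0 (R : realType) (d n : nat) : set (B R d n) := [set z | z.1 = 0].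

(* Gradients, with values in the dual of the space of the variable. *)
Definition grad_p (R : realType) (d n : nat) (F : B R d n -> R) (z : B R d n) :
    'M[R]_(d, n) :=
  \matrix_(j < d, i < n) 'D_(delta_mx i j) (fun p : 'M[R]_(n, d) => F (p, z.2)) z.1.

Definition grad_x (R : realType) (d n : nat) (F : B R d n -> R) (z : B R d n) :
    'rV[R]_d :=
  \row_(j < d) 'D_(delta_mx j 0) (fun x : 'cV[R]_d => F (z.1, x)) z.2.

(* C^infinity on U (meant for open U): all iterated directional derivatives of
   f are Frechet differentiable at every point of U. *)
Definition smooth_on (R : realType) (V : normedModType R) (U : set V) (f : V -> R) :
    Prop :=
  forall (vs : seq V) (x : V), U x ->
    differentiable (foldr (fun v (g : V -> R) => 'D_v g) f vs) x.

Definition S0 (R : realType) (d n : nat) (z : B R d n) : R :=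
  pairing (\sum_(i < n) row i z.1) z.2.

(* Germs at B0 are handled through representatives, which are total functions
   whose values matter only near B0; two representatives F and G define the
   same germ iff set_nbhs (@B0 R d n) [set z | F z = G z]. *)
Record Oloc (R : realType) (d n : nat) : Type := MkOloc {
  oloc_fun :> B R d n -> R;
  oloc_smooth : exists2 U : set (B R d n),
    open U /\ @B0 R d n `<=` U & smooth_on U oloc_fun;
  oloc_val0 : forall x : 'cV[R]_d, oloc_fun (0, x) = 0;
  oloc_grad0 : forall x : 'cV[R]_d, grad_p oloc_fun (0, x) = 0 }.

Definition gen_fun (R : realType) (d n : nat) (F : Oloc R d n) (z : B R d n) : R :=
  S0 z + F z.

(* The implicit system [sys z y], with parameter z in B n and unknown y, is
   uniquely solvable locally at B0, the solution being base x at z = (0, x),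
   and the solution satisfies [concl]: uniqueness is asked in a neighbourhood W
   of the set of all ((0, x), base x), for all z close enough to B0. *)
Definition locally_uniquely_solvable (R : realType) (d n : nat)
    (Y : topologicalType) (base : 'cV[R]_d -> Y)
    (sys concl : B R d n -> Y -> Prop) : Prop :=
  exists2 W : set (B R d n * Y),
    set_nbhs [set ((0, x) : B R d n, base x) | x in [set: 'cV[R]_d]] W &
    set_nbhs (@B0 R d n) [set z | exists y : Y,
      [/\ W (z, y), sys z y,
          (forall y' : Y, W (z, y') -> sys z y' -> y' = y) &
          concl z y]].

(* H is (near B0) the composition F(G_1, ..., G_n).  The i-th block of rows of
   p_G is p_(G_i); the equation e only serves to transport degrees. *)
Definition is_comp (R : realType) (d n : nat) (k : 'I_n -> nat) (m : nat)
    (e : m = (\sum_(i < n) k i)%N)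
    (F : B R d n -> R) (G : forall i : 'I_n, B R d (k i) -> R) (H : B R d m -> R) :
    Prop :=
  let argG (z : B R d m) (xG : 'M[R]_(d, n)) (i : 'I_n) : B R d (k i) :=
    (submxcol (castmx (e, erefl d) z.1) i, col i xG) in
  @locally_uniquely_solvable R d m ('M[R]_(n, d) * 'M[R]_(d, n))%type
    (fun x => (0, \matrix_(j < d, i < n) x j 0))
    (fun z y => let: (pF, xG) := y in
      pF = \matrix_(i < n) grad_x (G i) (argG z xG i) /\
      xG = grad_p F (pF, z.2))
    (fun z y => let: (pF, xG) := y in
      H z = \sum_(i < n) G i (argG z xG i) + F (pF, z.2)
            - \sum_(i < n) pairing (row i pF) (col i xG)).

(* The induced composition of the operad Oloc, as the graph of the operation:
   T represents the germ R(F; G_1, ..., G_n). *)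
Definition Oloc_comp (R : realType) (d n : nat) (k : 'I_n -> nat) (m : nat)
    (e : m = (\sum_(i < n) k i)%N)
    (F : Oloc R d n) (G : forall i : 'I_n, Oloc R d (k i)) (T : Oloc R d m) : Prop :=
  is_comp e (gen_fun F) (fun i => gen_fun (G i)) (gen_fun T).

Lemma foldr_derive0 (R : realType) (V : normedModType R) (vs : seq V) :
  foldr (fun v (g : V -> R) => 'D_v g) (fun=> 0) vs = fun=> 0.
Proof.
elim: vs => [//|v vs IH] /=; rewrite IH; apply/funext => x.
exact: derive_cst.
Qed.

Lemma Oloc0_smooth (R : realType) (d n : nat) :
  exists2 U : set (B R d n), open U /\ @B0 R d n `<=` U &
    smooth_on U (fun _ : B R d n => 0 : R).
Proof.
exists setT; first by split=> //; exact: openT.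
by move=> vs x _; rewrite foldr_derive0; exact: differentiable_cst.
Qed.

Lemma Oloc0_grad0 (R : realType) (d n : nat) (x : 'cV[R]_d) :
  grad_p (fun _ : B R d n => 0 : R) (0, x) = 0.
Proof. by apply/matrixP => j i; rewrite !mxE derive_cst. Qed.

Definition Oloc_unit (R : realType) (d : nat) : Oloc R d 1 :=
  @MkOloc R d 1 (fun=> 0) (@Oloc0_smooth R d 1) (fun=> erefl) (@Oloc0_grad0 R d 1).

Definition deg2 (k0 k1 : nat) (i : 'I_2) : nat := if i == 0 then k0 else k1.

Definition args2 (O : nat -> Type) (k0 k1 : nat) (a : O k0) (b : O k1) (i : 'I_2) :
    O (deg2 k0 k1 i) :=
  if i == 0 as c return O (if c then k0 else k1) then a else b.

Lemma deg2_sum (k0 k1 : nat) : (k0 + k1)%N = (\sum_(i < 2) deg2 k0 k1 i)%N.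
Proof. by rewrite !big_ord_recl big_ord0 addn0. Qed.

(* S(I, S) = S(S, I): since composition is given by its graph, T is the common
   value in O 3 of the two sides. *)
Definition is_product (O : nat -> Type)
    (comp : forall (n : nat) (k : 'I_n -> nat) (m : nat),
      m = (\sum_(i < n) k i)%N -> O n -> (forall i : 'I_n, O (k i)) -> O m -> Prop)
    (I : O 1%N) (S : O 2%N) : Prop :=
  exists T : O 3%N,
    comp 2%N (deg2 1 2) 3%N (deg2_sum 1 2) S (args2 I S) T /\
    comp 2%N (deg2 2 1) 3%N (deg2_sum 2 1) S (args2 S I) T.

Definition Oloc_product (R : realType) (d : nat) (S : Oloc R d 2) : Prop :=
  @is_product (Oloc R d) (@Oloc_comp R d) (Oloc_unit R d) S.

Definition pt2 (R : realType) (d : nat) (p q : 'rV[R]_d) (x : 'cV[R]_d) : B R d 2 :=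
  (col_mx p q, x).

(* The Symplectic Groupoid Associativity equation for S, with parameter
   z = (p1, p2, p3, x) in B 3 and unknown (xbar, pbar, xtilde, ptilde). *)
Definition SGA (R : realType) (d : nat) (S : B R d 2 -> R) : Prop :=
  @locally_uniquely_solvable R d 3
    ('cV[R]_d * 'rV[R]_d * 'cV[R]_d * 'rV[R]_d)%type
    (fun x => (x, 0, x, 0))
    (fun z y => let: (xb, pb, xt, pt) := y in
      let p1 := row 0 z.1 in let p2 := row 1 z.1 in let p3 := row 2%:R z.1 in
      let x := z.2 in
      [/\ xb = col 0 (grad_p S (pt2 pb p3 x)),
          pb = grad_x S (pt2 p1 p2 xb),
          xt = col 1 (grad_p S (pt2 p1 pt x)) &
          pt = grad_x S (pt2 p2 p3 xt)])
    (fun z y => let: (xb, pb, xt, pt) := y in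
      let p1 := row 0 z.1 in let p2 := row 1 z.1 in let p3 := row 2%:R z.1 in
      let x := z.2 in
      S (pt2 p1 p2 xb) + S (pt2 pb p3 x) - pairing pb xb
      = S (pt2 p2 p3 xt) + S (pt2 p1 pt x) - pairing pt xt).

(* Main.v *)
Require Import Defs.
From mathcomp Require Import all_boot all_order all_algebra.
From mathcomp Require Import all_classical all_reals all_analysis.
From mathcomp Require Import ring lra.
From HB Require Import structures.

(** Written out, the implicit system of S(I,S) says that the unit returns the
momentum p1, and what remains are the two equations for (xt, pt) of the
associativity system; in the same way S(S,I) leaves the two equations for
(xb, pb).  So the associativity system is the juxtaposition of the systems of
the two compositions.  In the values, the contribution of the unit is a
pairing that cancels against the correction term, and the two values become
the two sides of the associativity equation ([comp12_sysP], [comp12_valE] and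
their analogues).  If the compositions have a common value T, juxtaposing their
solutions therefore gives the associativity equation ([product_SGA]).

For the converse, the equation only says that the two values coincide; that
this common value is a germ in O_loc is the well-definedness of the
composition of generating functions, proved for all F and G_i
([comp_solution]).  Eliminating p_F leaves x_G = Psi(z, x_G) with
Psi(z, x_G) = grad_p F ((grad_x G_i(p_Gi, x_Gi))_i, x_F).  Each G_i vanishes
at p = 0, hence so do its first and second derivatives in x, and the derivative
of Psi in x_G is zero over B0.  Near every point of B0 the map Psi(z, -) is thus
a contraction, and Banach's theorem gives a locally unique solution y(z)
([implicit_solution]).  B0 is not compact and the size of the contraction
domain varies along it, so the uniqueness domain is a union of products of balls
small enough that two of them that meet lie in one contraction domain.

The solution is smooth because differentiating y = Psi(z, y) gives
Dy = (1 - d_y Psi)^-1 d_z Psi at (z, y(z)), where the inverse is a rational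
function of its entries by Cramer's rule: if y is differentiable k times then
so is Dy, Psi being smooth ([fixpoint_Ck]).  Finally the composite is tangent to S_0 along B0:
when it is differentiated, the variations of p_F and x_G cancel by the implicit
system itself ([generating_comp_val]).

In the converse direction the solutions of the two systems tend to the base
point, so their juxtaposition enters the uniqueness domain of the associativity
system and is its solution there; hence the two values agree near B0
([SGA_product]). *)

Set Implicit Arguments.
Unset Strict Implicit.
Unset Printing Implicit Defensive.

Import Order.TTheory GRing.Theory Num.Theory.
Import numFieldNormedType.Exports.

Local Open Scope classical_set_scope.
Local Open Scope ring_scope.

(** * Calculus of functions differentiable to a finite order *)

Section Differentiability.
Context {R : realType}.

(** Differentiability transfers along a difference that is o(y - x); this
replaces the construction of an explicit linear differential. *)
Lemma differentiable_near_sub (V W : normedModType R) (f g : V -> W) (x : V) :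
  differentiable g x ->
  (forall e : R, 0 < e -> \forall y \near x,
     `|f y - g y - (f x - g x)| <= e * `|y - x|) ->
  differentiable f x.
Proof.
move=> dg hfg.
suff dh : differentiable (f \- g) x.
  have -> : f = (f \- g) + g by apply/funext => y; rewrite /= /GRing.add /= subrK.
  exact: differentiableD.
have ho : (f \- g) \o shift x = cst ((f \- g) x) + (\0 : {linear V -> W}) +o_ 0 id.
  apply/eqaddoP => _/posnumP[e].
  have := hfg e%:num [gt0 of e%:num]; rewrite (near_shift 0) /=.
  apply: filterS => y; rewrite /= subr0 addrK.
  rewrite -[X in _ -> `|X| <= _]/(f (y + x) - g (y + x) - (f x - g x + 0)).
  by rewrite addr0.
have c0 : continuous (\0 : V -> W) by move=> z; exact: cvg_cst.
by apply/diff_locallyP; rewrite (diff_unique c0 ho).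
Qed.

Lemma near_eq_differentiable (V W : normedModType R) (f g : V -> W) (x : V) :
  (\forall y \near x, f y = g y) -> differentiable f x -> differentiable g x.
Proof.
move=> fg df; apply: (differentiable_near_sub df) => e e0.
have fgx : f x = g x := nbhs_singleton fg.
near=> y; have <- : f y = g y by near: y.
by rewrite fgx !subrr normr0 mulr_ge0 // ltW.
Unshelve. all: by end_near. Qed.

End Differentiability.


Lemma near_open_witness (R : realType) (V : normedModType R) (x : V) (P : V -> Prop) :
  (\forall y \near x, P y) -> exists U : set V, [/\ open U, U x & forall y, U y -> P y].
Proof.
move=> nP; have : nbhs x [set y | P y] by [].
by rewrite nbhsE => -[U [oU Ux] UP]; exists U.
Qed.

Section Calculus.
Context {R : realType}.

(** Order k is counted so that order 0 is mere differentiability: f and its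
iterated directional derivatives up to order k are differentiable on U. *)
Fixpoint Ck (V : normedModType R) (k : nat) (U : set V) (f : V -> R) : Prop :=
  (forall x, U x -> differentiable f x) /\
  (if k is k'.+1 then forall v, Ck k' U ('D_v f) else True).

Section CkTheory.
Variables (V : normedModType R) (U : set V).
Hypothesis oU : open U.

Lemma near_open x (P : set V) : (forall y, U y -> P y) -> U x -> \forall y \near x, P y.
Proof. by move=> UP Ux; apply: filterS UP _; exact: open_nbhs_nbhs. Qed.

Lemma Ck_diff k (f : V -> R) x : Ck k U f -> U x -> differentiable f x.
Proof. by case: k => [|k] [df _]; exact: df. Qed.

Lemma Ck_derive k (f : V -> R) v : Ck k.+1 U f -> Ck k U ('D_v f).
Proof. by case=> _; apply. Qed.

Lemma CkS k (f : V -> R) : Ck k.+1 U f -> Ck k U f.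
Proof.
elim: k f => [|k IH] f [df ddf]; first by split.
by split=> // v; apply: IH; exact: ddf.
Qed.

Lemma Ck_eq k (f g : V -> R) :
  (forall x, U x -> f x = g x) -> Ck k U f -> Ck k U g.
Proof.
elim: k f g => [|k IH] f g fg [df ddf]; split=> //.
- by move=> x Ux; apply: (near_eq_differentiable (near_open fg Ux)); exact: df.
- by move=> x Ux; apply: (near_eq_differentiable (near_open fg Ux)); exact: df.
- move=> v; apply: IH (ddf v) => x Ux.
  by apply: near_eq_derive; exact: near_open Ux.
Qed.

Lemma Ck_cst k (c : R) : Ck k U (fun=> c).
Proof.
elim: k c => [|k IH] c; split=> //; try by move=> x _; exact: differentiable_cst.
move=> v; have -> : 'D_v (fun=> c) = (fun=> 0) :> (V -> R).
  by apply/funext => x; exact: derive_cst.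
exact: IH.
Qed.

Lemma Ck_linear k (L : {linear V -> R}) : continuous L -> Ck k U L.
Proof.
move=> cL; have dL x : differentiable L x by exact: linear_differentiable.
case: k => [|k]; split=> // v.
have -> : 'D_v L = (fun=> L v) by apply/funext => x; rewrite deriveE// diff_lin.
exact: Ck_cst.
Qed.

Lemma CkD k (f g : V -> R) : Ck k U f -> Ck k U g -> Ck k U (fun x => f x + g x).
Proof.
elim: k f g => [|k IH] f g [df ddf] [dg ddg]; split=> //.
- by move=> x Ux; apply: differentiableD; [exact: df|exact: dg].
- by move=> x Ux; apply: differentiableD; [exact: df|exact: dg].
- move=> v; apply: Ck_eq (IH _ _ (ddf v) (ddg v)) => x Ux.
  by rewrite (@deriveD _ _ _ f g)//; apply: diff_derivable; [exact: df|exact: dg].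
Qed.

Lemma CkM k (f g : V -> R) : Ck k U f -> Ck k U g -> Ck k U (fun x => f x * g x).
Proof.
elim: k f g => [|k IH] f g Cf Cg; move: (Cf) (Cg) => [df ddf] [dg ddg]; split=> //.
- by move=> x Ux; apply: differentiableM; [exact: df|exact: dg].
- by move=> x Ux; apply: differentiableM; [exact: df|exact: dg].
- move=> v; apply: Ck_eq (CkD (IH _ _ (CkS Cf) (ddg v)) (IH _ _ (CkS Cg) (ddf v))).
  move=> x Ux; rewrite (@deriveM _ _ f g)//; apply: diff_derivable.
    exact: df.
  exact: dg.
Qed.

Lemma CkZ k c (f : V -> R) : Ck k U f -> Ck k U (fun x => c * f x).
Proof. by move=> Cf; apply: CkM => //; exact: Ck_cst. Qed.

Lemma CkN k (f : V -> R) : Ck k U f -> Ck k U (fun x => - f x).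
Proof. by move=> /(CkZ (-1)); apply: Ck_eq => x _; rewrite mulN1r. Qed.

Lemma CkB k (f g : V -> R) : Ck k U f -> Ck k U g -> Ck k U (fun x => f x - g x).
Proof. by move=> Cf Cg; apply: CkD => //; exact: CkN. Qed.

Lemma Ck_sum k (I : Type) (r : seq I) (P : pred I) (f : I -> V -> R) :
  (forall i, Ck k U (f i)) -> Ck k U (fun x => \sum_(i <- r | P i) f i x).
Proof.
move=> Cf; elim: r => [|i r IH].
  by apply: Ck_eq (Ck_cst k 0) => x _; rewrite big_nil.
case Pi: (P i); last by apply: Ck_eq IH => x _; rewrite big_cons Pi.
by apply: Ck_eq (CkD (Cf i) IH) => x _; rewrite big_cons Pi.
Qed.

Lemma Ck_prod k (I : Type) (r : seq I) (P : pred I) (f : I -> V -> R) :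
  (forall i, Ck k U (f i)) -> Ck k U (fun x => \prod_(i <- r | P i) f i x).
Proof.
move=> Cf; elim: r => [|i r IH].
  by apply: Ck_eq (Ck_cst k 1) => x _; rewrite big_nil.
case Pi: (P i); last by apply: Ck_eq IH => x _; rewrite big_cons Pi.
by apply: Ck_eq (CkM (Cf i) IH) => x _; rewrite big_cons Pi.
Qed.

Lemma CkV k (f : V -> R) : (forall x, U x -> f x != 0) ->
  Ck k U f -> Ck k U (fun x => (f x)^-1).
Proof.
move=> f0; elim: k f f0 => [|k IH] f f0 Cf; move: (Cf) => [df ddf]; split=> //.
- by move=> x Ux; apply: differentiableV; [exact: df|exact: f0].
- by move=> x Ux; apply: differentiableV; [exact: df|exact: f0].
- move=> v; have Ci := IH f f0 (CkS Cf).
  apply: Ck_eq (CkN (CkM (CkM Ci Ci) (ddf v))) => x Ux.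
  rewrite deriveV; [|exact: f0|by apply: diff_derivable; exact: df].
  by rewrite scaleNr -exprVn expr2.
Qed.

Lemma Ck_det k n (M : V -> 'M[R]_n) :
  (forall i j, Ck k U (fun x => M x i j)) -> Ck k U (fun x => \det (M x)).
Proof.
move=> CM; apply: Ck_sum => s; apply: CkZ; apply: Ck_prod => i; exact: CM.
Qed.

(** Cramer's rule: the inverse is the adjugate divided by the determinant. *)
Lemma Ck_invmx k n (M : V -> 'M[R]_n) :
  (forall x, U x -> M x \in unitmx) ->
  (forall i j, Ck k U (fun x => M x i j)) ->
  forall i j, Ck k U (fun x => invmx (M x) i j).
Proof.
move=> uM CM i j.
have C1 : Ck k U (fun x => (\det (M x))^-1).
  apply: CkV; last exact: Ck_det.
  by move=> x /uM; rewrite unitmxE unitfE.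
have C2 : Ck k U (fun x => cofactor (M x) j i).
  apply: CkZ; apply: Ck_det => a b.
  by apply: Ck_eq (CM (lift j a) (lift i b)) => x _; rewrite !mxE.
by apply: Ck_eq (CkM C1 C2) => x /uM ux; rewrite /invmx ux !mxE.
Qed.

End CkTheory.

Lemma Ck_subset (V : normedModType R) k (U U' : set V) f :
  U' `<=` U -> Ck k U f -> Ck k U' f.
Proof.
move=> UU; elim: k f => [|k IH] f [df ddf]; split=> //.
- by move=> x /UU /df.
- by move=> x /UU /df.
- by move=> v; apply: IH; exact: ddf.
Qed.

Lemma smooth_onP (V : normedModType R) (U : set V) f :
  smooth_on U f <-> forall k, Ck k U f.
Proof.
split=> [sf k|Cf vs x Ux].
  elim: k f sf => [|k IH] f sf; split=> //; try by move=> x Ux; exact: (sf [::]).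
  by move=> v; apply: IH => vs x Ux; have := sf (rcons vs v) x Ux; rewrite foldr_rcons.
elim/last_ind: vs f Cf => [|vs v IH] f Cf; first exact: (Ck_diff (Cf 0%N)).
by rewrite foldr_rcons; apply: IH => k; exact: (Ck_derive v (Cf k.+1)).
Qed.

Section Chain.
Variables (Z V : normedModType R) (I : finType) (L : {linear Z -> V}).
Variables (c : I -> Z -> R) (e : I -> V).
Hypothesis cL : continuous L.

(** The maps L + \sum_i c_i e_i, with L linear and scalar coefficients c_i, are
the inner maps of every composite below.  For them the chain rule only involves
derivatives in fixed directions, hence can be iterated. *)
Lemma diff_combination x :
  (forall i, differentiable (c i) x) ->
  is_diff x (fun z => L z + \sum_i c i z *: e i)
    (fun v => L v + \sum_i 'D_v (c i) x *: e i).
Proof.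
move=> dc.
have ds (r : seq I) : is_diff x (fun z => \sum_(i <- r) c i z *: e i)
    (fun v => \sum_(i <- r) 'D_v (c i) x *: e i).
  elim: r => [|i r IH].
    have -> : (fun z => \sum_(i <- [::]) c i z *: e i) = cst 0.
      by apply/funext => z; rewrite big_nil.
    by apply: is_diff_eq; apply/funext => v; rewrite big_nil.
  have dci : is_diff x (fun z => c i z *: e i) (fun v => 'D_v (c i) x *: e i).
    apply: DiffDef; first exact: differentiableZl.
    by rewrite diffZl//; apply/funext => v; rewrite deriveE.
  have -> : (fun z => \sum_(i <- i :: r) c i z *: e i) =
     (fun z => c i z *: e i) + (fun z => \sum_(i <- r) c i z *: e i).
    by apply/funext => z; rewrite big_cons.
  by apply: is_diff_eq; apply/funext => v; rewrite big_cons.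
have dL : is_diff x L L by apply: DiffDef; [exact: linear_differentiable|exact: diff_lin].
exact: (is_diffD dL (ds (index_enum I))).
Qed.

Lemma differentiable_comb (f : V -> R) x :
  (forall i, differentiable (c i) x) ->
  differentiable f (L x + \sum_i c i x *: e i) ->
  differentiable (fun z => f (L z + \sum_i c i z *: e i)) x.
Proof.
move=> dc df; have [dg _] := diff_combination dc.
exact: (@differentiable_comp _ _ _ _ (fun z => L z + \sum_i c i z *: e i) f).
Qed.

Lemma derive_comb (f : V -> R) x v :
  (forall i, differentiable (c i) x) ->
  differentiable f (L x + \sum_i c i x *: e i) ->
  'D_v (fun z => f (L z + \sum_i c i z *: e i)) x =
  'D_(L v) f (L x + \sum_i c i x *: e i) +
  \sum_i 'D_v (c i) x * 'D_(e i) f (L x + \sum_i c i x *: e i).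
Proof.
move=> dc df; have [dg eg] := diff_combination dc.
rewrite (deriveE v (differentiable_comb dc df)).
rewrite (@diff_comp _ _ _ _ (fun z => L z + \sum_i c i z *: e i) f)//=.
rewrite eg linearD linear_sum deriveE//; congr (_ + _); apply: eq_bigr => i _.
by rewrite linearZ (deriveE (e i) df).
Qed.

(** By the chain rule, a derivative of the composite is a sum of products of
functions of the same form and of derivatives of the c_i, one order lower. *)
Lemma Ck_comb k (U : set Z) (O : set V) (f : V -> R) :
  open U -> (forall i, Ck k U (c i)) -> Ck k O f ->
  (forall z, U z -> O (L z + \sum_i c i z *: e i)) ->
  Ck k U (fun z => f (L z + \sum_i c i z *: e i)).
Proof.
move=> oU; elim: k f => [|k IH] f Cc Cf UO; split=> //.
- move=> x Ux; apply: differentiable_comb => [i|].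
    exact: Ck_diff (Cc i) Ux.
  by apply: Ck_diff Cf _; exact: UO.
- move=> x Ux; apply: differentiable_comb => [i|].
    exact: Ck_diff (Cc i) Ux.
  by apply: Ck_diff Cf _; exact: UO.
- move=> v; have Cc' i : Ck k U (c i) by exact: CkS.
  have H1 w := IH _ Cc' (Ck_derive w Cf) UO.
  apply: (Ck_eq oU _ (CkD oU (H1 (L v)) (Ck_sum oU _ _
    (fun i => CkM oU (Ck_derive v (Cc i)) (H1 (e i)))))) => x Ux.
  rewrite derive_comb// => [i|].
    exact: Ck_diff (Cc i) Ux.
  by apply: Ck_diff Cf _; exact: UO.
Qed.

End Chain.
End Calculus.

(** * Regularity of solutions of fixed-point equations *)

Section FixedPoint.
Context {R : realType}.

Lemma pair_cvg (T : Type) (F : set_system T) {FF : Filter F}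
    (U V : topologicalType) (f : T -> U) (g : T -> V) (a : U) (b : V) :
  f x @[x --> F] --> a -> g x @[x --> F] --> b -> (f x, g x) @[x --> F] --> (a, b).
Proof. by move=> fa gb; exact: (cvg_pair fa gb). Qed.

Lemma rV_norm_le N (v : 'rV[R]_N) (b : R) :
  0 <= b -> (forall j, `|v 0 j| <= b) -> `|v| <= b.
Proof.
move=> b0 vb; rewrite [`|v|]mx_normrE; apply/bigmax_leP; split=> // -[i j] _ /=.
by rewrite ord1.
Qed.

Lemma mx_coord_le m n (M : 'M[R]_(m, n)) i j : `|M i j| <= `|M|.
Proof.
rewrite [`|M|]mx_normrE.
exact: (le_bigmax_cond _ (fun ij : 'I_m * 'I_n => `|M ij.1 ij.2|) (j := (i, j))).
Qed.

(** The little-o form of differentiability, with explicit constants. *)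
Lemma differentiable_eps (V : normedModType R) (f : V -> R) x :
  differentiable f x -> forall e : R, 0 < e ->
  \forall y \near x, `|f y - f x - 'd f x (y - x)| <= e * `|y - x|.
Proof.
move=> df e e0; have := diff_locally df.
move=> /eqaddoP/(_ e e0); rewrite [X in _ -> X](near_shift 0) /=.
apply: filterS => y.
rewrite /= subr0 addrK -[X in `|X| <= _ -> _]/(f (y + x) - (f x + 'd f x y)).
by rewrite opprD addrA.
Qed.

Lemma differentiable_lip (V : normedModType R) (f : V -> R) x :
  differentiable f x -> exists2 k : R, 0 < k &
  \forall y \near x, `|f y - f x| <= k * `|y - x|.
Proof.
move=> df; have [k k0 hk] := linear_lipschitz (diff_continuous df).
exists (1 + k); first by rewrite addr_gt0.
apply: filterS (differentiable_eps df ltr01) => y hy.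
rewrite -(subrK ('d f x (y - x)) (f y - f x)) mulrDl.
by apply: le_trans (ler_normD _ _) _; apply: lerD.
Qed.

Variables (Z : normedModType R) (N : nat).

Definition injl (z : Z) : Z * 'rV[R]_N := (z, 0).

Fact injl_linear : linear injl.
Proof. by move=> a u v; rewrite /injl; congr (_, _); rewrite /= ?scaler0 ?addr0. Qed.

HB.instance Definition _ :=
  GRing.isLinear.Build R Z (Z * 'rV[R]_N)%type _ injl injl_linear.

Lemma injl_continuous : continuous injl.
Proof. by move=> z; apply: pair_cvg; [exact: cvg_id|exact: cvg_cst]. Qed.

Definition dy (i : 'I_N) : Z * 'rV[R]_N := (0, delta_mx 0 i).

Lemma pair_comb (z : Z) (u : 'rV[R]_N) : (z, u) = injl z + \sum_i u 0 i *: dy i.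
Proof.
have -> : \sum_i u 0 i *: dy i = (0, u).
  rewrite [u in RHS]row_sum_delta.
  elim: (index_enum _) => [|i r IH]; first by rewrite !big_nil.
  by rewrite !big_cons IH /dy; congr (_, _); rewrite /= ?scaler0 ?addr0.
by rewrite /injl; congr (_, _); rewrite /= ?addr0 ?add0r.
Qed.

Section FixedPointMap.
Variables (Psi : 'I_N -> Z * 'rV[R]_N -> R) (y : Z -> 'rV[R]_N).

(** Transposed partial Jacobian in the unknown, so that it acts on row vectors
by right multiplication. *)
Definition jac (p : Z * 'rV[R]_N) : 'M[R]_N :=
  \matrix_(i, j) 'D_(dy i) (Psi j) p.

(** With k = y z - y z0 and B the partial Jacobian, the equation reads
k (1 - B) = (Psi(z, y z0) - Psi(z0, y z0)) + o(|z - z0| + |k|).  Multiplying by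
(1 - B)^-1 bounds |k| by a multiple of |z - z0|, and then shows that y differs by
o(z - z0) from Psi(z, y z0) (1 - B)^-1, which is differentiable in z. *)
Lemma fixpoint_differentiable z0 :
  {for z0, continuous y} ->
  (forall j, differentiable (Psi j) (z0, y z0)) ->
  (\forall z \near z0, forall j, y z 0 j = Psi j (z, y z)) ->
  1%:M - jac (z0, y z0) \in unitmx ->
  forall j, differentiable (fun z => y z 0 j) z0.
Proof.
move=> cy dPsi fixy uB.
set p0 := (z0, y z0) in dPsi uB *; set c := invmx (1%:M - jac p0).
pose g z : 'rV[R]_N := \row_j Psi j (z, y z0).
have dg i : differentiable (fun z => g z 0 i) z0.
  have -> : (fun z => g z 0 i) =
      (fun z => Psi i (injl z + \sum_i y z0 0 i *: dy i)).
    by apply/funext => z; rewrite mxE pair_comb.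
  apply: (@differentiable_comb _ _ _ _ _ (fun i => cst (y z0 0 i))).
  - exact: injl_continuous.
  - by move=> k; exact: differentiable_cst.
  - by rewrite -pair_comb.
have [K K0 gK] : exists2 K : R, 0 < K & \forall z \near z0,
    forall j, `|(g z *m c) 0 j - (g z0 *m c) 0 j| <= K * `|z - z0|.
  have /choice[k kP] : forall j, exists k : R, 0 < k /\ \forall z \near z0,
      `|(g z *m c) 0 j - (g z0 *m c) 0 j| <= k * `|z - z0|.
    move=> j; have [|k k0 hk] := @differentiable_lip _ (fun z => (g z *m c) 0 j) z0.
      have -> : (fun z => (g z *m c) 0 j) = \sum_i (fun z => g z 0 i * c i j).
        by apply/funext => z; rewrite mxE fct_sumE.
      apply: differentiable_sum => i.
      by apply: differentiableM; [exact: dg|exact: differentiable_cst].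
    by exists k.
  have k_ge0 j : 0 <= k j by case: (kP j) => /ltW.
  exists (1 + \sum_j k j); first by rewrite ltr_pwDl// sumr_ge0.
  apply: filter_forall => j; apply: filterS (proj2 (kP j)) => z /le_trans; apply.
  rewrite ler_wpM2r// (bigD1 j)//= addrCA lerDl addr_ge0// sumr_ge0//.
have [M M0 hM] : exists2 M : R, 0 < M & forall (r : 'rV[R]_N) (b : R),
    0 <= b -> (forall j, `|r 0 j| <= b) -> `|r *m c| <= M * b.
  exists (1 + \sum_j \sum_i `|c i j|).
    by rewrite ltr_pwDl// sumr_ge0// => j _; rewrite sumr_ge0.
  have S0 j : 0 <= \sum_i `|c i j| by rewrite sumr_ge0.
  move=> r b b0 rb; apply: rV_norm_le => [|j].
    by rewrite mulr_ge0// addr_ge0// sumr_ge0.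
  rewrite mxE (le_trans (ler_norm_sum _ _ _))//.
  apply: (@le_trans _ _ ((\sum_i `|c i j|) * b)).
    rewrite mulr_suml ler_sum// => i _; rewrite normrM mulrC.
    by rewrite ler_wpM2l.
  rewrite ler_wpM2r// [X in _ + X](bigD1 j)//= addrCA lerDl addr_ge0//.
  by rewrite sumr_ge0.
move=> j0.
apply: (@differentiable_near_sub _ _ _ _ (fun z => (g z *m c) 0 j0)).
  have -> : (fun z => (g z *m c) 0 j0) = \sum_i (fun z => g z 0 i * c i j0).
    by apply/funext => z; rewrite mxE fct_sumE.
  apply: differentiable_sum => i.
  by apply: differentiableM; [exact: dg|exact: differentiable_cst].
move=> e e0.
(* del <= 1/2 absorbs |k| into the left-hand side, giving |k| <= (2 K + 1) |h|;
   then del (|h| + |k|) <= del (2 K + 2) |h| <= e |h|. *)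
pose del := Num.min 2^-1 (e / (2 * K + 2)).
have K2 : 0 < 2 * K + 2 by rewrite addr_gt0// mulr_gt0.
have del0 : 0 < del by rewrite lt_min invr_gt0 ltr0n divr_gt0.
have del2 : del <= 2^-1 by rewrite ge_min lexx.
have dele : del * (2 * K + 2) <= e by rewrite -ler_pdivlMr// ge_min lexx orbT.
(* The remainder r is a difference of two Frechet remainders, whence the 2. *)
pose e' := del / (2 * M).
have e'0 : 0 < e' by rewrite divr_gt0// mulr_gt0.
have Me : M * (2 * e') = del by rewrite /e'; field; rewrite gt_eqF.
have H1 : \forall z \near z0, forall j,
    `|Psi j (z, y z) - Psi j p0 - 'd (Psi j) p0 ((z, y z) - p0)|
      <= e' * `|(z, y z) - p0|.
  apply: filter_forall => j.
  have cp : (z, y z) @[z --> z0] --> p0 by apply: pair_cvg; [exact: cvg_id|exact: cy].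
  exact: cp (differentiable_eps (dPsi j) e'0).
have H2 : \forall z \near z0, forall j,
    `|Psi j (z, y z0) - Psi j p0 - 'd (Psi j) p0 ((z, y z0) - p0)|
      <= e' * `|(z, y z0) - p0|.
  apply: filter_forall => j.
  have cp : (z, y z0) @[z --> z0] --> p0.
    by apply: pair_cvg; [exact: cvg_id|exact: cvg_cst].
  exact: cp (differentiable_eps (dPsi j) e'0).
have fix0 := nbhs_singleton fixy.
near=> z.
have hyz : forall j, `|Psi j (z, y z) - Psi j p0 - 'd (Psi j) p0 ((z, y z) - p0)|
    <= e' * `|(z, y z) - p0| by near: z.
have hy0 : forall j, `|Psi j (z, y z0) - Psi j p0 - 'd (Psi j) p0 ((z, y z0) - p0)|
    <= e' * `|(z, y z0) - p0| by near: z.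
have hg : forall j, `|(g z *m c) 0 j - (g z0 *m c) 0 j| <= K * `|z - z0| by near: z.
have fixz : forall j, y z 0 j = Psi j (z, y z) by near: z.
set h := z - z0; set k := y z - y z0.
pose r : 'rV[R]_N := \row_j (Psi j (z, y z) - Psi j (z, y z0) - (k *m jac p0) 0 j).
have rP j : `|r 0 j| <= 2 * e' * (`|h| + `|k|).
  have dk : (k *m jac p0) 0 j =
      'd (Psi j) p0 ((z, y z) - p0) - 'd (Psi j) p0 ((z, y z0) - p0).
    rewrite -linearB opprB addrA subrK.
    have -> : (z, y z) - (z, y z0) = injl 0 + \sum_i k 0 i *: dy i.
      by rewrite -pair_comb; congr (_, _); rewrite /= subrr.
    rewrite linearD [injl 0]linear0 linear0 add0r linear_sum mxE.
    by apply: eq_bigr => i _; rewrite linearZ !mxE deriveE.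
  rewrite mxE dk.
  rewrite [X in `|X|](_ : _ =
    (Psi j (z, y z) - Psi j p0 - 'd (Psi j) p0 ((z, y z) - p0)) -
    (Psi j (z, y z0) - Psi j p0 - 'd (Psi j) p0 ((z, y z0) - p0))); last by ring.
  apply: le_trans (ler_normB _ _) _.
  rewrite mulrDl !mul1r -mulr2n mulrnAl mulr2n; apply: lerD.
    apply: le_trans (hyz j) _; rewrite ler_wpM2l ?(ltW e'0)//.
    rewrite prod_normE ge_max; apply/andP; split; first by rewrite lerDl.
    by rewrite lerDr.
  apply: le_trans (hy0 j) _; rewrite ler_wpM2l ?(ltW e'0)//.
  rewrite prod_normE ge_max; apply/andP; split; first by rewrite lerDl.
  by rewrite /= subrr normr0 addr_ge0.
have kE : k = r *m c + (g z *m c - g z0 *m c).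
  have : k *m (1%:M - jac p0) = r + (g z - g z0).
    apply/rowP => j; rewrite mulmxBr mulmx1.
    have -> : (k - k *m jac p0) 0 j = k 0 j - (k *m jac p0) 0 j by rewrite !mxE.
    have -> : (r + (g z - g z0)) 0 j = r 0 j + (g z 0 j - g z0 0 j) by rewrite !mxE.
    have -> : r 0 j = Psi j (z, y z) - Psi j (z, y z0) - (k *m jac p0) 0 j.
      by rewrite [in LHS]mxE.
    have -> : k 0 j = Psi j (z, y z) - Psi j (z0, y z0).
      by rewrite -fixz -fix0 !mxE.
    by rewrite /g !mxE; ring.
  by move/(congr1 (mulmx^~ c)); rewrite mulmxK// mulmxDl mulmxBl.
have rcP : `|r *m c| <= del * (`|h| + `|k|).
  rewrite -Me -mulrA; apply: hM => //.
  by apply: mulr_ge0; [rewrite mulr_ge0 ?(ltW e'0)|rewrite addr_ge0].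
have kh : `|k| <= (2 * K + 1) * `|h|.
  have : `|k| <= del * (`|h| + `|k|) + K * `|h|.
    rewrite [in leLHS]kE; apply: le_trans (ler_normD _ _) _; apply: lerD => //.
    apply: rV_norm_le => [|j]; first by rewrite mulr_ge0// ltW.
    by have := hg j; congr (`|_| <= _); rewrite !mxE.
  have : del * (`|h| + `|k|) <= 2^-1 * (`|h| + `|k|) by rewrite ler_wpM2r// addr_ge0.
  have := normr_ge0 h.
  by lra.
rewrite [X in `|X|](_ : _ = (r *m c) 0 j0); last first.
  have := congr1 (fun v : 'rV_N => v 0 j0) kE; rewrite !mxE => E.
  by rewrite -[RHS](addrK (((g z *m c) 0 j0) - (g z0 *m c) 0 j0)) !mxE -E; ring.
apply: le_trans (mx_coord_le _ _ _) _; apply: le_trans rcP _.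
apply: le_trans (ler_wpM2r (normr_ge0 _) dele); rewrite -mulrA ler_wpM2l ?(ltW del0)//.
by have := normr_ge0 h; lra.
Unshelve. all: by end_near. Qed.
(** Differentiate y z = Psi(z, y z) and solve the resulting linear equation. *)
Lemma fixpoint_derive z0 v :
  (\forall z \near z0, forall j, y z 0 j = Psi j (z, y z)) ->
  (forall j, differentiable (Psi j) (z0, y z0)) ->
  (forall j, differentiable (fun z => y z 0 j) z0) ->
  1%:M - jac (z0, y z0) \in unitmx ->
  forall j, 'D_v (fun z => y z 0 j) z0 =
  \sum_i 'D_(injl v) (Psi i) (z0, y z0) * invmx (1%:M - jac (z0, y z0)) i j.
Proof.
move=> fixy dPsi dyj uB j.
pose w : 'rV[R]_N := \row_j 'D_v (fun z => y z 0 j) z0.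
pose a : 'rV[R]_N := \row_j 'D_(injl v) (Psi j) (z0, y z0).
have wE : w = a + w *m jac (z0, y z0).
  apply/rowP => k; rewrite !mxE.
  rewrite (near_eq_derive (g := fun z => Psi k (injl z + \sum_i y z 0 i *: dy i))).
    rewrite derive_comb -?pair_comb//; last exact: injl_continuous.
    by congr (_ + _); apply: eq_bigr => i _; rewrite !mxE.
  by apply: filterS fixy => z; rewrite -pair_comb.
have : w *m (1%:M - jac (z0, y z0)) = a.
  by rewrite mulmxBr mulmx1 {1}wE addrK.
move/(congr1 (fun u => (u *m invmx (1%:M - jac (z0, y z0))) 0 j)).
rewrite mulmxK// !mxE => ->; apply: eq_bigr => i _.
by rewrite [in LHS]mxE.
Qed.

(** Bootstrap: the formula for the derivative of y involves y only through
functions already known to have order k. *)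
Lemma fixpoint_Ck k (U : set Z) (O : set (Z * 'rV[R]_N)) :
  open U -> (forall z, U z -> O (z, y z)) ->
  (forall j, Ck k O (Psi j)) ->
  (forall z, U z -> {for z, continuous y}) ->
  (forall z, U z -> forall j, y z 0 j = Psi j (z, y z)) ->
  (forall z, U z -> 1%:M - jac (z, y z) \in unitmx) ->
  forall j, Ck k U (fun z => y z 0 j).
Proof.
move=> oU UO; elim: k => [|k IH] CPsi cy fixy uB j.
  split=> // z Uz; apply: fixpoint_differentiable => //; first exact: cy.
  - by move=> i; apply: Ck_diff (CPsi i) _; exact: UO.
  - exact: near_open Uz.
  - exact: uB.
have {IH}Cy : forall j, Ck k U (fun z => y z 0 j).
  by apply: IH => // i; exact: CkS.
split=> [z Uz|v]; first exact: Ck_diff (Cy j) Uz.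
have Ccomp f : Ck k O f -> Ck k U (fun z => f (z, y z)).
  move=> Cf.
  have UO' z : U z -> O (injl z + \sum_i y z 0 i *: dy i).
    by rewrite -pair_comb; exact: UO.
  apply: (Ck_eq oU _ (Ck_comb injl_continuous oU Cy Cf UO')) => z Uz.
  by rewrite -pair_comb.
have Ca i : Ck k U (fun z => 'D_(injl v) (Psi i) (z, y z)).
  by apply: (Ccomp ('D_(injl v) (Psi i))); exact: Ck_derive.
have Cc i : Ck k U (fun z => invmx (1%:M - jac (z, y z)) i j).
  apply: (@Ck_invmx _ _ _ oU _ _ (fun z => 1%:M - jac (z, y z))) => // a b.
  have CJ : Ck k U (fun z => 'D_(dy a) (Psi b) (z, y z)).
    by apply: (Ccomp ('D_(dy a) (Psi b))); exact: Ck_derive.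
  apply: (Ck_eq oU _ (CkB oU (Ck_cst U k ((1%:M : 'M[R]_N) a b)) CJ)) => z Uz.
  by rewrite !mxE.
apply: (Ck_eq oU _ (Ck_sum oU _ _ (fun i => CkM oU (Ca i) (Cc i)))) => z Uz.
rewrite fixpoint_derive//.
- exact: near_open Uz.
- by move=> i; apply: Ck_diff (CPsi i) _; exact: UO.
- by move=> i; exact: Ck_diff (Cy i) Uz.
- exact: uB.
Qed.
End FixedPointMap.
End FixedPoint.

(** * Germs of smooth functions *)

(** Matrices form a complete normed module, as needed for fixed points. *)
HB.instance Definition _ (R : realType) m n := Complete.on 'M[R]_(m, n).

Section SmoothNear.
Context {R : realType}.

Definition smooth_pt (V : normedModType R) (f : V -> R) (x : V) : Prop :=
  forall vs : seq V, differentiable (foldr (fun v (g : V -> R) => 'D_v g) f vs) x.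

(** The neighbourhood is common to all iterated derivatives, so that a function
which is smooth near each point of a set is smooth on one open set. *)
Definition smooth_near (V : normedModType R) (f : V -> R) (x : V) : Prop :=
  \forall y \near x, smooth_pt f y.

Lemma smooth_ptD (V : normedModType R) (f : V -> R) v x :
  smooth_pt f x -> smooth_pt ('D_v f) x.
Proof. by move=> sf vs; have := sf (rcons vs v); rewrite foldr_rcons. Qed.

Lemma smooth_near_derive (V : normedModType R) (f : V -> R) v x :
  smooth_near f x -> smooth_near ('D_v f) x.
Proof. by apply: filterS => y; exact: smooth_ptD. Qed.

Lemma smooth_near_diff (V : normedModType R) (f : V -> R) x :
  smooth_near f x -> differentiable f x.
Proof. by move/nbhs_singleton => /(_ [::]). Qed.

Lemma smooth_nearW (V : normedModType R) (U : set V) (f : V -> R) x :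
  open U -> U x -> (forall k, Ck k U f) -> smooth_near f x.
Proof. by move=> oU Ux /smooth_onP sf; apply: near_open Ux => // y Uy vs; exact: sf. Qed.

Lemma smooth_near_Ck (V : normedModType R) (f : V -> R) x :
  smooth_near f x -> exists U : set V, [/\ open U, U x & forall k, Ck k U f].
Proof.
move=> /near_open_witness[U [oU Ux sU]].
by exists U; split=> //; apply/smooth_onP => vs y /sU; exact.
Qed.

Lemma smooth_near_cst (V : normedModType R) (c : R) (x : V) :
  smooth_near (fun=> c) x.
Proof. by apply: (smooth_nearW openT) => // k; exact: Ck_cst. Qed.

Lemma smooth_near_linear (V : normedModType R) (L : {linear V -> R}) x :
  continuous L -> smooth_near L x.
Proof. by move=> cL; apply: (smooth_nearW openT) => // k; exact: Ck_linear. Qed.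

(** Lifts the closure properties of finite order to germs: the two functions
are first restricted to a common open set. *)
Lemma smooth_near2 (V : normedModType R) (F : (V -> R) -> (V -> R) -> V -> R) f g x :
  (forall k (U : set V) a b, open U -> Ck k U a -> Ck k U b -> Ck k U (F a b)) ->
  smooth_near f x -> smooth_near g x -> smooth_near (F f g) x.
Proof.
move=> CF /smooth_near_Ck[U [oU Ux CU]] /smooth_near_Ck[U' [oU' Ux' CU']].
apply: (smooth_nearW (openI oU oU')) => // k.
apply: CF; first exact: openI.
- by apply: Ck_subset (CU k) => y [].
- by apply: Ck_subset (CU' k) => y [].
Qed.

Lemma smooth_nearD (V : normedModType R) (f g : V -> R) x :
  smooth_near f x -> smooth_near g x -> smooth_near (fun z => f z + g z) x.
Proof. by apply: (smooth_near2 (F := fun f g z => f z + g z)) => *; exact: CkD. Qed.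

Lemma smooth_nearB (V : normedModType R) (f g : V -> R) x :
  smooth_near f x -> smooth_near g x -> smooth_near (fun z => f z - g z) x.
Proof. by apply: (smooth_near2 (F := fun f g z => f z - g z)) => *; exact: CkB. Qed.

Lemma smooth_nearM (V : normedModType R) (f g : V -> R) x :
  smooth_near f x -> smooth_near g x -> smooth_near (fun z => f z * g z) x.
Proof. by apply: (smooth_near2 (F := fun f g z => f z * g z)) => *; exact: CkM. Qed.

Lemma smooth_near_sum (V : normedModType R) (I : Type) (r : seq I) (f : I -> V -> R) x :
  (forall i, smooth_near (f i) x) -> smooth_near (fun z => \sum_(i <- r) f i z) x.
Proof.
move=> sf; elim: r => [|i r IH].
  have -> : (fun z => \sum_(i <- [::]) f i z) = (fun=> 0).
    by apply/funext => z; rewrite big_nil.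
  exact: smooth_near_cst.
have -> : (fun z => \sum_(i <- i :: r) f i z) =
    (fun z => f i z + \sum_(i <- r) f i z).
  by apply/funext => z; rewrite big_cons.
exact: smooth_nearD.
Qed.

Lemma smooth_near_comb (Z V : normedModType R) (I : finType) (L : {linear Z -> V})
    (c : I -> Z -> R) (e : I -> V) (f : V -> R) x :
  continuous L -> (forall i, smooth_near (c i) x) ->
  smooth_near f (L x + \sum_i c i x *: e i) ->
  smooth_near (fun z => f (L z + \sum_i c i z *: e i)) x.
Proof.
move=> cL sc sf.
have [dg _] := diff_combination e cL (fun i => smooth_near_diff (sc i)).
have cg := differentiable_continuous dg.
pose O := [set p | smooth_pt f p]°.
have nO : \forall z \near x, O (L z + \sum_i c i z *: e i).
  by apply: cg; exact: nbhs_interior sf.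
have nc : \forall z \near x, forall i, smooth_pt (c i) z by apply: filter_forall.
have /near_open_witness[U [oU Ux sU]] : \forall z \near x,
  O (L z + \sum_i c i z *: e i) /\ forall i, smooth_pt (c i) z by exact: filterI.
apply: (smooth_nearW oU) => // k; apply: (@Ck_comb _ _ _ _ _ _ _ cL _ _ O) => //.
- by move=> i; move: k; apply/smooth_onP => vs y /sU[_ ]; exact.
- by move: k; apply/smooth_onP => vs p /interior_subset; exact.
- by move=> z /sU[].
Qed.
End SmoothNear.

Section MeanValue.
Context {R : realType}.

Lemma derive_line (V : normedModType R) (f : V -> R) (a v : V) (t : R) :
  derivable f (a + t *: v) v ->
  is_derive t 1 (fun s => f (a + s *: v)) ('D_v f (a + t *: v)).
Proof.
have E : (fun h : R => h^-1 *: (f (a + (h *: 1 + t) *: v) - f (a + t *: v))) =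
    (fun h : R => h^-1 *: (f (h *: v + (a + t *: v)) - f (a + t *: v))).
  apply/funext => h; rewrite [h *: 1]mulr1 scalerDl.
  by congr (_ *: (f _ - _)); rewrite addrCA.
move=> df; apply: DeriveDef; first by rewrite /derivable /= E.
by rewrite /derive /= E.
Qed.

Lemma derive_pair0 (Z : normedModType R) N (f : Z * 'rV[R]_N -> R) p (w : 'rV[R]_N) :
  differentiable f p -> 'D_((0, w)) f p = \sum_i w 0 i * 'D_(dy Z i) f p.
Proof.
move=> df; rewrite deriveE// pair_comb [injl N 0]linear0 add0r linear_sum.
by apply: eq_bigr => i _; rewrite linearZ deriveE.
Qed.

End MeanValue.

(** * Solving a fixed-point equation along a set *)

Section Implicit.
Context {R : realType}.
Variables (Z : normedModType R) (N : nat) (A : set Z) (b : Z -> 'rV[R]_N).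
Variable Psi : 'I_N -> Z * 'rV[R]_N -> R.
Hypothesis cb : forall z, A z -> {for z, continuous b}.
Hypothesis sPsi : forall z j, A z -> smooth_near (Psi j) (z, b z).
Hypothesis fixb : forall z j, A z -> b z 0 j = Psi j (z, b z).
Hypothesis dPsi0 : forall z i j, A z -> 'D_(dy Z i) (Psi j) (z, b z) = 0.

Definition solves (z : Z) (u : 'rV[R]_N) := forall j, u 0 j = Psi j (z, u).

Let contracting z0 e := forall (z : Z) (u : 'rV[R]_N), `|z0 - z| < e -> `|b z0 - u| < e ->
  [/\ forall j, smooth_pt (Psi j) (z, u), 1%:M - jac Psi (z, u) \in unitmx &
      forall (u' : 'rV[R]_N) j, `|b z0 - u'| < e ->
        `|Psi j (z, u) - Psi j (z, u')| <= 2^-1 * `|u - u'|].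

(** The partial Jacobian of Psi is zero at (z0, b z0), hence small nearby; the
mean value theorem on the segment from u' to u gives the Lipschitz constant. *)
Lemma contracting_near_base z0 : A z0 -> exists2 e, 0 < e & contracting z0 e.
Proof.
move=> Az0.
pose P (p : Z * 'rV[R]_N) := [/\ forall j, smooth_pt (Psi j) p,
  forall j i, `|'D_(dy Z i) (Psi j) p| < 2^-1 / (1 + N%:R) &
  \det (1%:M - jac Psi p) != 0].
have cvg_val (f : Z * 'rV[R]_N -> R) (p : Z * 'rV[R]_N) l :
  {for p, continuous f} -> f p = l -> f q @[q --> p] --> l by move=> + <-.
have nP : nbhs (z0, b z0) P.
  have cD i j : {for (z0, b z0), continuous ('D_(dy Z i) (Psi j))}.
    apply: differentiable_continuous; apply: smooth_near_diff.
    by apply: smooth_near_derive; exact: sPsi.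
  have n1 : \forall p \near (z0, b z0), forall j, smooth_pt (Psi j) p.
    apply: (@filter_forall _ _ (fun j p => smooth_pt (Psi j) p)
      (nbhs (z0, b z0))) => j.
    exact: sPsi.
  have n2 : \forall p \near (z0, b z0), forall j i,
      `|'D_(dy Z i) (Psi j) p| < 2^-1 / (1 + N%:R).
    apply: (@filter_forall _ _ (fun j p => forall i, `|'D_(dy Z i) (Psi j) p| < _)
      (nbhs (z0, b z0))) => j.
    apply: (@filter_forall _ _ (fun i p => `|'D_(dy Z i) (Psi j) p| < _)
      (nbhs (z0, b z0))) => i.
    have D0 := cvg_val _ _ _ (cD i j) (dPsi0 i j Az0).
    move/cvgr0Pnorm_lt : D0; apply.
    by rewrite divr_gt0// ?invr_gt0// ltr_pwDl.
  have n3 : \forall p \near (z0, b z0), \det (1%:M - jac Psi p) != 0.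
    have cdet : {for (z0, b z0), continuous (fun p => \det (1%:M - jac Psi p))}.
      apply: differentiable_continuous.
      have [U [oU Up sU]] := near_open_witness n1.
      apply: (@Ck_diff _ _ U 0) => //; apply: Ck_det => // i j.
      have CD : Ck 0 U ('D_(dy Z i) (Psi j)).
        have /smooth_onP/(_ 1%N) : smooth_on U (Psi j).
          by move=> vs p Upp; exact: (sU _ Upp j vs).
        exact: Ck_derive.
      apply: (Ck_eq oU _ (CkB oU (Ck_cst U 0 ((1%:M : 'M[R]_N) i j)) CD)) => p _.
      by rewrite !mxE.
    have d1 : \det (1%:M - jac Psi (z0, b z0)) = 1.
      rewrite (_ : jac _ _ = 0) ?subr0 ?det1//.
      by apply/matrixP => i j; rewrite !mxE dPsi0.
    have det1 : \det (1%:M - jac Psi p) @[p --> (z0, b z0)] --> (1 : R).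
      exact: (cvg_val _ _ _ cdet d1).
    by move/cvgr_neq0 : det1; apply; exact: oner_neq0.
  by apply: filterS3 n1 n2 n3 => p.
move: nP => /nbhs_ballP[e e0 eP]; exists e => // z u zz0 uz0.
have inP (u' : 'rV[R]_N) : `|b z0 - u'| < e -> P (z, u').
  by move=> u'z0; apply: eP; split; rewrite -ball_normE.
have [s1 _ s3] := inP _ uz0; split=> //; first by rewrite unitmxE unitfE.
move=> u' j u'z0; pose w : 'rV[R]_N := u - u'; rewrite -/w.
pose q (t : R) : Z * 'rV[R]_N := (z, u') + t *: (0, w).
have qE (t : R) : q t = (z, u' + t *: w) by congr (_, _); rewrite /= scaler0 addr0.
have Pq (t : R) : 0 <= t <= 1 -> P (q t).
  move=> /andP[t0 t1]; rewrite qE; apply: inP.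
  have -> : b z0 - (u' + t *: w) = (1 - t) *: (b z0 - u') + t *: (b z0 - u).
    by apply/rowP => i; rewrite /w !mxE; ring.
  apply: le_lt_trans (ler_normD _ _) _.
  rewrite !normrZ (ger0_norm t0) ger0_norm ?subr_ge0//.
  have [->|tn0] := eqVneq t 0; first by rewrite subr0 mul1r mul0r addr0.
  rewrite (_ : e = (1 - t) * e + t * e); last by ring.
  apply: ler_ltD; first by rewrite ler_wpM2l ?subr_ge0// ltW.
  by rewrite ltr_pM2l// lt_def tn0.
have dq (t : R) : 0 <= t <= 1 ->
    is_derive t 1 (fun s : R => Psi j (q s)) ('D_((0, w)) (Psi j) (q t)).
  move=> /Pq[sj _ _]; apply: derive_line; apply: diff_derivable.
  exact: (sj j [::]).
have [||c c01] := @MVT_segment R (fun s : R => Psi j (q s))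
    (fun t => 'D_((0, w)) (Psi j) (q t)) 0 1 ler01.
- by move=> t; rewrite in_itv /= => /andP[t0 t1]; apply: dq; rewrite !ltW.
- apply: continuous_in_subspaceT => t; rewrite inE /= in_itv /= => t01.
  by apply: differentiable_continuous; apply/derivable1_diffP; case: (dq t t01).
have -> : q 1 = (z, u) by rewrite qE scale1r /w addrC subrK.
have -> : q 0 = (z, u') by rewrite qE scale0r addr0.
move=> ->; rewrite subr0 mulr1.
move: c01; rewrite in_itv /= => /Pq[sc lc _].
rewrite derive_pair0; last exact: (sc j [::]).
apply: le_trans (ler_norm_sum _ _ _) _.
apply: (@le_trans _ _ (\sum_(i < N) `|w| * (2^-1 / (1 + N%:R)))).
  apply: ler_sum => i _; rewrite normrM ler_pM// ?mx_coord_le//.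
  by rewrite ltW// lc.
rewrite sumr_const card_ord -[X in X <= _]mulr_natr -mulrA [X in _ <= X]mulrC ler_wpM2l//.
by rewrite mulrAC ler_pdivrMr ?ltr_pwDl// ler_wpM2l ?invr_ge0// lerDr.
Qed.

Lemma contracting_unique z0 e z (u u' : 'rV[R]_N) : contracting z0 e -> `|z0 - z| < e ->
  `|b z0 - u| < e -> `|b z0 - u'| < e -> solves z u -> solves z u' -> u = u'.
Proof.
move=> gz zz0 uz0 u'z0 su su'; have [_ _ L] := gz _ _ zz0 uz0.
have : `|u - u'| <= 2^-1 * `|u - u'|.
  apply: rV_norm_le => [|j]; first by rewrite mulr_ge0.
  by rewrite !mxE su su'; exact: L.
have := normr_ge0 (u - u') => n0 n1.
by apply/eqP; rewrite -subr_eq0 -normr_eq0; apply/eqP; lra.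
Qed.

(** Banach's theorem on the closed ball of radius r, which Psi(z, -) preserves as
soon as Psi(z, b z0) is within r / 2 of b z0. *)
Lemma contracting_solvable z0 e (r : R) : A z0 -> contracting z0 e -> 0 < r -> r < e ->
  exists2 d, 0 < d & forall z, `|z0 - z| < d ->
    exists2 u, `|b z0 - u| <= r & solves z u.
Proof.
move=> Az0 gz r0 re.
have n1 : \forall z \near z0, forall j,
    `|Psi j (z0, b z0) - Psi j (z, b z0)| <= 2^-1 * r.
  apply: filter_forall => j.
  have cp : (z, b z0) @[z --> z0] --> (z0, b z0).
    by apply: pair_cvg; [exact: cvg_id|exact: cvg_cst].
  have cPsi := differentiable_continuous (smooth_near_diff (sPsi j Az0)).
  have /cvgrPdist_le := cvg_comp _ _ cp cPsi.
  by apply; rewrite mulr_gt0// invr_gt0.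
have n2 : \forall z \near z0, `|z0 - z| < e.
  by apply/nbhs_normP; exists e => //=; exact: lt_trans re.
have /nbhs_normP[d /= d0 dP] : \forall z \near z0, (forall j,
    `|Psi j (z0, b z0) - Psi j (z, b z0)| <= 2^-1 * r) /\ `|z0 - z| < e.
  exact: filterI.
exists d => // z /dP[h1 h2].
pose f (u : 'rV[R]_N) : 'rV[R]_N := \row_j Psi j (z, u).
pose U := closed_ball (b z0) r.
have UE (u : 'rV[R]_N) : U u <-> `|b z0 - u| <= r by rewrite /U closed_ballE.
have lipf (u u' : 'rV[R]_N) : U u -> U u' -> `|f u - f u'| <= 2^-1 * `|u - u'|.
  move=> /UE Uu /UE Uu'; apply: rV_norm_le => [|j]; first by rewrite mulr_ge0.
  have [_ _ L] := gz z u h2 (le_lt_trans Uu re).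
  by rewrite !mxE; apply: L; exact: le_lt_trans re.
have Ub : U (b z0) by apply/UE; rewrite subrr normr0 ltW.
have fU : set_fun U U f.
  move=> u Uu; apply/UE; rewrite -(subrK (f (b z0)) (b z0)) -addrA.
  apply: le_trans (ler_normD _ _) _; rewrite (splitr r); apply: lerD.
    apply: rV_norm_le => [|j]; first by rewrite divr_ge0// ltW.
    by rewrite !mxE fixb// mulrC; exact: h1.
  apply: le_trans (lipf _ _ Ub Uu) _; rewrite mulrC ler_wpM2r ?invr_ge0//.
  exact/UE.
have ctr : is_contraction (mkfun_fun fU).
  exists (2^-1)%:nng; split; first by rewrite /= invf_lt1// ltr1n.
  by move=> [u u'] /= [Uu Uu']; exact: lipf.
have [u Uu uE] := banach_fixed_point ctr (@closed_ball_closed _ _ _ _)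
  (ex_intro _ _ Ub).
exists u; first exact/UE.
by move=> j; rewrite [in LHS]uE mxE.
Qed.

(** W is the union over z0 in A of products of balls of radius eta z0.  If (z, u)
and (z, u') belong to the products of z0 and z1, then z0 and z1 are at distance
less than twice the larger radius; eta is chosen from the continuity of b so that
b z0 and b z1 are then close, and u and u' both lie in the contraction domain of
the centre with the larger radius. *)
Theorem implicit_solution : exists (W : set (Z * 'rV[R]_N)) (y : Z -> 'rV[R]_N),
  [/\ forall z, A z -> nbhs (z, b z) W,
      forall z, A z -> y z = b z,
      forall z j, A z -> smooth_near (fun z => y z 0 j) z &
      forall z, A z -> \forall z' \near z,
        [/\ W (z', y z'), solves z' (y z') &
            forall u, W (z', u) -> solves z' u -> u = y z']].
Proof.
have /choice[eps epsP] : forall z, exists e : R, A z -> 0 < e /\ contracting z e.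
  move=> z; have [/contracting_near_base[e e0 ge]|nAz] := pselect (A z).
    by exists e.
  by exists 0.
have /choice[eta etaP] : forall z, exists h : R, A z -> [/\ 0 < h, h <= eps z / 4 &
    forall z', A z' -> `|z - z'| < 2 * h -> `|b z - b z'| < eps z / 4].
  move=> z; have [Az|nAz] := pselect (A z); last by exists 0.
  have [e0 _] := epsP _ Az.
  have e4 : 0 < eps z / 4 by rewrite divr_gt0.
  have := cb Az; rewrite /continuous_at => /cvgrPdist_lt/(_ _ e4)/nbhs_normP[h /= h0 hP].
  exists (Num.min (eps z / 4) (h / 2)) => _; split.
  - by rewrite lt_min e4 divr_gt0.
  - by rewrite ge_min lexx.
  - move=> z' _ /lt_le_trans zz'; apply: hP => /=; apply: zz'.
    by rewrite mulrC -ler_pdivlMr// ge_min lexx orbT.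
have /choice[del delP] : forall z, exists d : R, A z -> [/\ 0 < d, d <= eta z &
    forall z', `|z - z'| < d -> exists2 u, `|b z - u| < eta z & solves z' u].
  move=> z; have [Az|nAz] := pselect (A z); last by exists 0.
  have [e0 ge] := epsP _ Az; have [h0 he _] := etaP _ Az.
  have [||d d0 dP] := @contracting_solvable z (eps z) (eta z / 2) Az ge.
  - by rewrite divr_gt0.
  - by lra.
  exists (Num.min d (eta z)) => _; split; first by rewrite lt_min d0.
    by rewrite ge_min lexx orbT.
  move=> z'; rewrite lt_min => /andP[/dP[u ub su] _]; exists u => //.
  by apply: le_lt_trans ub _; lra.
pose W (p : Z * 'rV[R]_N) := exists z0, [/\ A z0, `|z0 - p.1| < eta z0 &
  `|b z0 - p.2| < eta z0].
have Wuniq z u u' : W (z, u) -> W (z, u') -> solves z u -> solves z u' -> u = u'.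
  move=> [z0 /= [Az0 zz0 uz0]] [z1 /= [Az1 zz1 uz1]].
  wlog le10 : z0 z1 u u' Az0 Az1 zz0 zz1 uz0 uz1 / eta z1 <= eta z0.
    move=> WL su su'; case: (leP (eta z1) (eta z0)) => [|/ltW] le10.
      exact: (WL z0 z1).
    by apply/esym; exact: (WL z1 z0).
  have [e0 ge] := epsP _ Az0; have [h0 he hb] := etaP _ Az0.
  have b01 : `|b z0 - b z1| < eps z0 / 4.
    apply: hb => //; apply: le_lt_trans (ler_distD z _ _) _.
    by rewrite (distrC z z1); lra.
  apply: (contracting_unique ge); [by lra|by lra|].
  by apply: le_lt_trans (ler_distD (b z1) _ _) _; lra.
pose y z := xget (b z) [set u | W (z, u) /\ solves z u].
have yP z u : W (z, u) -> solves z u -> y z = u.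
  move=> Wu su; have [Wy sy] : W (z, y z) /\ solves z (y z).
    by apply: (@xgetPex _ (b z) [set u | W (z, u) /\ solves z u]); exists u.
  exact: Wuniq Wy Wu sy su.
have Wb z : A z -> W (z, b z).
  by move=> Az; have [h0 _ _] := etaP _ Az; exists z; rewrite /= !subrr !normr0.
have yb z : A z -> y z = b z by move=> Az; apply: yP (Wb _ Az) _ => j; exact: fixb.
have ynear z0 z : A z0 -> `|z0 - z| < del z0 ->
    [/\ W (z, y z), solves z (y z) & `|b z0 - y z| < eta z0].
  move=> Az0 zz0; have [d0 dh /(_ _ zz0)[u uz0 su]] := delP _ Az0.
  have Wu : W (z, u) by exists z0; split => //; exact: lt_le_trans dh.
  by rewrite (yP _ _ Wu su).
exists W, y; split=> //.
- move=> z Az; have [h0 _ _] := etaP _ Az; apply/nbhs_ballP; exists (eta z) => //.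
  by move=> [z' u'] [/=]; rewrite -!ball_normE /= => zz' zu'; exists z.
- move=> z0 j Az0.
  have [e0 ge] := epsP _ Az0; have [h0 he hb] := etaP _ Az0.
  have [d0 dh _] := delP _ Az0.
  pose U := ball z0 (del z0).
  have oU : open U := @ball_open _ _ _ _.
  have UE z : U z -> `|z0 - z| < del z0 by rewrite /U -ball_normE.
  pose O : set (Z * 'rV[R]_N) :=
    [set p | `|z0 - p.1| < eps z0 /\ `|b z0 - p.2| < eps z0].
  have UO z : U z -> O (z, y z).
    by move=> /UE zz0; have [_ _ yz] := ynear _ _ Az0 zz0; split => /=; lra.
  have gO p : O p -> [/\ forall j, smooth_pt (Psi j) p, 1%:M - jac Psi p \in unitmx &
      forall (u' : 'rV[R]_N) j, `|b z0 - u'| < eps z0 ->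
        `|Psi j p - Psi j (p.1, u')| <= 2^-1 * `|p.2 - u'|].
    by case: p => z u [/= zz0 uz0]; exact: ge.
  have CPsi k i : Ck k O (Psi i).
    by move: k; apply/smooth_onP => vs p /gO[sp _ _]; exact: sp.
  have cy z1 : U z1 -> {for z1, continuous y}.
    move=> Uz1; have [_ sy1 y1] := ynear _ _ Az0 (UE _ Uz1).
    have cPsi i := differentiable_continuous (Ck_diff (CPsi 0%N i) (UO _ Uz1)).
    apply/cvgrPdist_le => e epos; near=> z.
    have Uz : U z by near: z; exact: open_nbhs_nbhs.
    have [_ sy yz] := ynear _ _ Az0 (UE _ Uz); have [_ _ L] := gO _ (UO _ Uz).
    have h1 : forall i, `|Psi i (z1, y z1) - Psi i (z, y z1)| <= e / 2.
      near: z; apply: filter_forall => i.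
      have cp : (z, y z1) @[z --> z1] --> (z1, y z1).
        by apply: pair_cvg; [exact: cvg_id|exact: cvg_cst].
      have /cvgrPdist_le := cvg_comp _ _ cp (cPsi i).
      by apply; rewrite divr_gt0.
    have : `|y z1 - y z| <= e / 2 + 2^-1 * `|y z1 - y z|.
      apply: rV_norm_le => [|i]; first by rewrite addr_ge0 ?mulr_ge0 ?(ltW epos).
      rewrite !mxE sy1 sy.
      apply: le_trans (ler_distD (Psi i (z, y z1)) _ _) _; apply: lerD; first exact: h1.
      rewrite distrC (distrC (y z1)); apply: L; lra.
    by lra.
  have sU z : U z -> forall i, y z 0 i = Psi i (z, y z).
    by move=> /UE zz0; have [] := ynear _ _ Az0 zz0.
  have uU z : U z -> 1%:M - jac Psi (z, y z) \in unitmx by move=> /UO/gO[].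
  apply: (smooth_nearW oU); first exact: ballxx.
  move=> k; exact: (fixpoint_Ck oU UO (CPsi k) cy sU uU).
- move=> z0 Az0; have [d0 _ _] := delP _ Az0.
  apply/nbhs_normP; exists (del z0) => // z zz0.
  have [Wy sy _] := ynear _ _ Az0 zz0; split=> // u Wu su.
  by rewrite (yP _ _ Wu su).
Unshelve. all: by end_near. Qed.

End Implicit.

(** * Matrix-valued limits and the chain rule on B *)

Section MatrixCalculus.
Context {R : realType}.

(** The norm of matrices is the maximum of the entries. *)
Lemma cvg_mx (T : Type) (F : set_system T) {FF : Filter F} m n
    (f : T -> 'M[R]_(m, n)) (M : 'M[R]_(m, n)) :
  (forall i j, f t i j @[t --> F] --> M i j) -> f t @[t --> F] --> M.
Proof.
move=> fM; apply/cvgrPdist_le => e e0.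
have : \forall t \near F, forall i j, `|M i j - f t i j| <= e.
  apply: filter_forall => i; apply: filter_forall => j.
  by have /cvgrPdist_le := fM i j; exact.
apply: filterS => t ft; rewrite [`|_|]mx_normrE; apply/bigmax_leP.
by split=> [|[i j] _ /=]; [exact: ltW|rewrite !mxE].
Qed.

Lemma cvg_coord (T : Type) (F : set_system T) {FF : Filter F} m n
    (f : T -> 'M[R]_(m, n)) (M : 'M[R]_(m, n)) i j :
  f t @[t --> F] --> M -> f t i j @[t --> F] --> M i j.
Proof. by move=> fM; exact: (cvg_comp _ _ fM (@coord_continuous R m n i j M)). Qed.

Lemma cvg_col_mx (T : Type) (F : set_system T) {FF : Filter F} m1 m2 n
    (f : T -> 'M[R]_(m1, n)) (g : T -> 'M[R]_(m2, n))
    (A : 'M[R]_(m1, n)) (D : 'M[R]_(m2, n)) :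
  f t @[t --> F] --> A -> g t @[t --> F] --> D ->
  col_mx (f t) (g t) @[t --> F] --> col_mx A D.
Proof.
move=> fA gD; apply: cvg_mx => i a; under eq_cvg do rewrite mxE; rewrite mxE.
by case: splitP => j _; exact: cvg_coord.
Qed.

Lemma cvg_row_mx (T : Type) (F : set_system T) {FF : Filter F} m n1 n2
    (f : T -> 'M[R]_(m, n1)) (g : T -> 'M[R]_(m, n2))
    (A : 'M[R]_(m, n1)) (D : 'M[R]_(m, n2)) :
  f t @[t --> F] --> A -> g t @[t --> F] --> D ->
  row_mx (f t) (g t) @[t --> F] --> row_mx A D.
Proof.
move=> fA gD; apply: cvg_mx => a i; under eq_cvg do rewrite mxE; rewrite mxE.
by case: splitP => j _; exact: cvg_coord.
Qed.

Lemma cvg_row (T : Type) (F : set_system T) {FF : Filter F} m n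
    (f : T -> 'M[R]_(m, n)) (M : 'M[R]_(m, n)) i :
  f t @[t --> F] --> M -> row i (f t) @[t --> F] --> row i M.
Proof.
move=> fM; apply: cvg_mx => j a; under eq_cvg do rewrite mxE; rewrite mxE.
exact: cvg_coord.
Qed.

Lemma cvg_col (T : Type) (F : set_system T) {FF : Filter F} m n
    (f : T -> 'M[R]_(m, n)) (M : 'M[R]_(m, n)) i :
  f t @[t --> F] --> M -> col i (f t) @[t --> F] --> col i M.
Proof.
move=> fM; apply: cvg_mx => j a; under eq_cvg do rewrite mxE; rewrite mxE.
exact: cvg_coord.
Qed.

Definition mx_coord m n i j (M : 'M[R]_(m, n)) : R := M i j.

Fact mx_coord_linear m n i j : linear (@mx_coord m n i j).
Proof. by move=> a u v; rewrite /mx_coord !mxE. Qed.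

HB.instance Definition _ m n i j :=
  GRing.isLinear.Build R 'M[R]_(m, n) R _ (@mx_coord m n i j) (mx_coord_linear i j).

Lemma derive_linear (V : normedModType R) (L : {linear V -> R}) v x :
  continuous L -> 'D_v L x = L v.
Proof. by move=> cL; rewrite deriveE ?diff_lin//; exact: linear_differentiable. Qed.

Lemma derive_sumE (V : normedModType R) (I : Type) (r : seq I) (f : I -> V -> R) v x :
  (forall i, differentiable (f i) x) ->
  'D_v (fun z => \sum_(i <- r) f i z) x = \sum_(i <- r) 'D_v (f i) x.
Proof.
move=> df.
suff [] : differentiable (fun z => \sum_(i <- r) f i z) x /\
  'D_v (fun z => \sum_(i <- r) f i z) x = \sum_(i <- r) 'D_v (f i) x by [].
elim: r => [|i r [IHd IH]].
  have -> : (fun z => \sum_(i <- [::]) f i z) = cst 0.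
    by apply/funext => z; rewrite big_nil.
  by rewrite derive_cst big_nil; split=> //; exact: differentiable_cst.
have -> : (fun z => \sum_(i <- i :: r) f i z) = f i + (fun z => \sum_(i <- r) f i z).
  by apply/funext => z; rewrite big_cons.
rewrite deriveD; [|exact: diff_derivable|exact: diff_derivable].
by rewrite IH big_cons; split=> //; exact: differentiableD.
Qed.

Variables d n : nat.

Definition dp (i : 'I_n) (a : 'I_d) : B R d n := (delta_mx i a, 0).
Definition dx (a : 'I_d) : B R d n := (0, delta_mx a 0).

Lemma grad_pE (F : B R d n -> R) z a i : grad_p F z a i = 'D_(dp i a) F z.
Proof.
case: z => p x; rewrite mxE /derive /=.
have -> : (fun h : R => h^-1 *: (F (h *: delta_mx i a + p, x) - F (p, x))) =
    (fun h : R => h^-1 *: (F (h *: dp i a + (p, x)) - F (p, x))); last by [].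
apply/funext => h; congr (_ *: (F _ - _)).
by congr (_, _); rewrite /= scaler0 add0r.
Qed.

Lemma grad_xE (F : B R d n -> R) z a : grad_x F z 0 a = 'D_(dx a) F z.
Proof.
case: z => p x; rewrite mxE /derive /=.
have -> : (fun h : R => h^-1 *: (F (p, h *: delta_mx a 0 + x) - F (p, x))) =
    (fun h : R => h^-1 *: (F (h *: dx a + (p, x)) - F (p, x))); last by [].
apply/funext => h; congr (_ *: (F _ - _)).
by congr (_, _); rewrite /= scaler0 add0r.
Qed.

Section Comp.
Variable Z : normedModType R.

Definition smoothB (g : Z -> B R d n) (z : Z) : Prop :=
  (forall i a, smooth_near (fun z => (g z).1 i a) z) /\
  (forall a, smooth_near (fun z => (g z).2 a 0) z).

Let basis (s : 'I_n * 'I_d + 'I_d) : B R d n :=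
  match s with inl ia => dp ia.1 ia.2 | inr a => dx a end.
Let coordinate (g : Z -> B R d n) (s : 'I_n * 'I_d + 'I_d) (z : Z) : R :=
  match s with inl ia => (g z).1 ia.1 ia.2 | inr a => (g z).2 a 0 end.

Lemma B_comb (g : Z -> B R d n) z :
  g z = (\0 : {linear Z -> B R d n}) z + \sum_s coordinate g s z *: basis s.
Proof.
rewrite /= add0r big_sumType /=.
have -> : \sum_(ia : 'I_n * 'I_d) (g z).1 ia.1 ia.2 *: dp ia.1 ia.2 = ((g z).1, 0).
  rewrite [(g z).1 in RHS]matrix_sum_delta pair_big /=.
  elim: (index_enum _) => [|ia r IH]; first by rewrite !big_nil.
  by rewrite !big_cons IH /dp; congr (_, _); rewrite /= ?scaler0 ?addr0.
have -> : \sum_a (g z).2 a 0 *: dx a = (0, (g z).2).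
  rewrite [(g z).2 in RHS]matrix_sum_delta.
  under [in RHS]eq_bigr => a _ do rewrite big_ord1.
  elim: (index_enum _) => [|a r IH]; first by rewrite !big_nil.
  by rewrite !big_cons IH /dx; congr (_, _); rewrite /= ?scaler0 ?addr0.
by rewrite [LHS]surjective_pairing; congr (_, _); rewrite /= ?addr0 ?add0r.
Qed.

Lemma smooth_near_compB (f : B R d n -> R) (g : Z -> B R d n) z :
  smooth_near f (g z) -> smoothB g z -> smooth_near (fun z => f (g z)) z.
Proof.
move=> sf [sp sx].
have -> : (fun z => f (g z)) =
    (fun z => f ((\0 : {linear Z -> B R d n}) z + \sum_s coordinate g s z *: basis s)).
  by apply/funext => w; rewrite -B_comb.
apply: smooth_near_comb.
- by move=> w; exact: cvg_cst.
- by move=> [[i a]|a]; [exact: sp|exact: sx].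
- by rewrite -B_comb.
Qed.

Lemma derive_compB (f : B R d n -> R) (g : Z -> B R d n) z v :
  smooth_near f (g z) -> smoothB g z ->
  'D_v (fun z => f (g z)) z =
  \sum_i \sum_a 'D_v (fun z => (g z).1 i a) z * 'D_(dp i a) f (g z) +
  \sum_a 'D_v (fun z => (g z).2 a 0) z * 'D_(dx a) f (g z).
Proof.
move=> sf [sp sx].
have -> : (fun z => f (g z)) =
    (fun z => f ((\0 : {linear Z -> B R d n}) z + \sum_s coordinate g s z *: basis s)).
  by apply/funext => w; rewrite -B_comb.
rewrite derive_comb.
- rewrite -B_comb derive0 add0r big_sumType /=; congr (_ + _).
  by rewrite pair_big.
- by move=> w; exact: cvg_cst.
- by move=> [[i a]|a]; apply: smooth_near_diff; [exact: sp|exact: sx].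
- by rewrite -B_comb; exact: smooth_near_diff.
Qed.
End Comp.
End MatrixCalculus.

(** * Composition of generating functions *)

Section Generating.
Context {R : realType}.
Variable d : nat.

(** Representatives of the germs S_0 + F with F in O_loc: the conditions on F
are equivalent to these conditions on the sum. *)
Definition generating n (F : B R d n -> R) : Prop :=
  [/\ forall x, smooth_near F (0, x),
      forall x, F (0, x) = 0 &
      forall x i a, 'D_(dp i a) F (0, x) = x a 0].

Lemma derive_dx_B0 n (f : B R d n -> R) x a :
  (forall x, f (0, x) = 0) -> 'D_(dx n a) f (0, x) = 0.
Proof.
move=> f0; rewrite -grad_xE mxE /=.
have -> : (fun x => f (0, x)) = cst 0 by apply/funext => y; rewrite f0.
exact: derive_cst.
Qed.

Lemma smooth_near_cvg (V : normedModType R) (f : V -> R) x l :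
  f x = l -> smooth_near f x -> f z @[z --> x] --> l.
Proof. by move=> <- /smooth_near_diff /differentiable_continuous. Qed.

Lemma smoothB_id n (z : B R d n) : smoothB id z.
Proof.
split=> [i a|a].
  apply: (@smooth_near_linear _ _ (@mx_coord R n d i a \o fst)) => w.
  by apply: continuous_comp; [exact: cvg_fst|exact: coord_continuous].
apply: (@smooth_near_linear _ _ (@mx_coord R d 1 a 0 \o snd)) => w.
by apply: continuous_comp; [exact: cvg_snd|exact: coord_continuous].
Qed.

Lemma derive_z1 n (z v : B R d n) i a : 'D_v (fun z : B R d n => z.1 i a) z = v.1 i a.
Proof.
apply: (@derive_linear _ _ (@mx_coord R n d i a \o fst)) => w.
by apply: continuous_comp; [exact: cvg_fst|exact: coord_continuous].
Qed.

Lemma derive_z2 n (z v : B R d n) a : 'D_v (fun z : B R d n => z.2 a 0) z = v.2 a 0.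
Proof.
apply: (@derive_linear _ _ (@mx_coord R d 1 a 0 \o snd)) => w.
by apply: continuous_comp; [exact: cvg_snd|exact: coord_continuous].
Qed.

Lemma S0E n (z : B R d n) : S0 z = \sum_i \sum_a z.1 i a * z.2 a 0.
Proof.
rewrite /S0 /pairing mxE exchange_big /=; apply: eq_bigr => a _.
by rewrite summxE mulr_suml; apply: eq_bigr => i _; rewrite mxE.
Qed.

Lemma smooth_near_S0 n (z : B R d n) : smooth_near (@S0 R d n) z.
Proof.
have -> : @S0 R d n = (fun z => \sum_i \sum_a z.1 i a * z.2 a 0).
  by apply/funext => w; exact: S0E.
have [s1 s2] := smoothB_id z.
apply: smooth_near_sum => i; apply: smooth_near_sum => a.
by apply: smooth_nearM; [exact: s1|exact: s2].
Qed.

Lemma derive_S0 n (z v : B R d n) :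
  'D_v (@S0 R d n) z = \sum_i \sum_a (v.1 i a * z.2 a 0 + z.1 i a * v.2 a 0).
Proof.
have -> : @S0 R d n = (fun z => \sum_i \sum_a z.1 i a * z.2 a 0).
  by apply/funext => w; exact: S0E.
have [s1 s2] := smoothB_id z.
have sM i a : smooth_near (fun z : B R d n => z.1 i a * z.2 a 0) z.
  by apply: smooth_nearM; [exact: s1|exact: s2].
rewrite derive_sumE => [|i]; last first.
  by apply: smooth_near_diff; apply: smooth_near_sum => a; exact: sM.
apply: eq_bigr => i _; rewrite derive_sumE => [|a]; last exact: smooth_near_diff.
apply: eq_bigr => a _; rewrite deriveM.
- by rewrite derive_z1 derive_z2 addrC /GRing.scale /= mulrC.
- exact: diff_derivable (smooth_near_diff (s1 i a)).
- exact: diff_derivable (smooth_near_diff (s2 a)).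
Qed.

Lemma derive_dp_S0 n x i a : 'D_(dp i a) (@S0 R d n) (0, x) = x a 0.
Proof.
rewrite derive_S0 (bigD1 i)//= (bigD1 a)//= !mxE !eqxx mul1r mul0r addr0.
rewrite [X in _ + X + _]big1 ?addr0 => [|b ba]; last first.
  by rewrite !mxE eqxx (negPf ba) !mul0r addr0.
rewrite big1 ?addr0// => k ki; rewrite big1// => b _.
by rewrite !mxE (negPf ki) !mul0r addr0.
Qed.

Lemma Oloc_smooth_near n (F : Oloc R d n) x : smooth_near F (0, x).
Proof.
have [U [oU BU] sU] := oloc_smooth F.
by apply: (smooth_nearW oU); [exact: BU|apply/smooth_onP].
Qed.

Lemma generating_gen_fun n (F : Oloc R d n) : generating (gen_fun F).
Proof.
split=> [x|x|x i a].
- by apply: smooth_nearD; [exact: smooth_near_S0|exact: Oloc_smooth_near].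
- rewrite /gen_fun oloc_val0 addr0 S0E big1// => i _; rewrite big1// => a _.
  by rewrite mxE mul0r.
- rewrite (@deriveD _ _ _ (@S0 R d n) F) ?derive_dp_S0.
  + by rewrite -grad_pE oloc_grad0 mxE addr0.
  + exact: diff_derivable (smooth_near_diff (smooth_near_S0 _)).
  + exact: diff_derivable (smooth_near_diff (Oloc_smooth_near _ _)).
Qed.

(** Subtract S_0; the condition along B0 holds on an open set because smoothness
near a point is an open condition. *)
Lemma generating_Oloc n (H : B R d n -> R) : generating H ->
  exists T : Oloc R d n, gen_fun T = H.
Proof.
move=> [sH H0 dH]; pose T z := H z - S0 z.
have sT x : smooth_near T (0, x).
  by apply: smooth_nearB; [exact: sH|exact: smooth_near_S0].
have T0 x : T (0, x) = 0.
  rewrite /T H0 S0E big1 ?subr0// => i _; rewrite big1// => a _.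
  by rewrite mxE mul0r.
have TU : exists2 U : set (B R d n), open U /\ @B0 R d n `<=` U & smooth_on U T.
  exists [set z | smooth_pt T z]°.
    by split; [exact: open_interior|move=> [p x] p0; have -> : p = 0 := p0; exact: sT].
  by move=> vs z /interior_subset; exact.
have gT x : grad_p T (0, x) = 0.
  apply/matrixP => a i; rewrite grad_pE (@deriveB _ _ _ H (@S0 R d n)).
  - by rewrite dH derive_dp_S0 subrr mxE.
  - exact: diff_derivable (smooth_near_diff (sH _)).
  - exact: diff_derivable (smooth_near_diff (smooth_near_S0 _)).
exists (MkOloc TU T0 gT); apply/funext => z.
by rewrite /gen_fun /= /T addrC subrK.
Qed.

Section Composition.
Variables (n : nat) (k : 'I_n -> nat) (m : nat) (e : m = (\sum_(i < n) k i)%N).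
Variables (F : B R d n -> R) (G : forall i : 'I_n, B R d (k i) -> R).

(** The point (p_Gi, x_Gi) at which G_i is evaluated. *)
Definition arg (z : B R d m) (xG : 'M[R]_(d, n)) (i : 'I_n) : B R d (k i) :=
  (submxcol (castmx (e, erefl d) z.1) i, col i xG).

Definition block (i : 'I_n) (q : 'I_(k i)) : 'I_m := cast_ord (esym e) (tagnat.Rank i q).

Lemma argE z xG i q a : (arg z xG i).1 q a = z.1 (block q) a.
Proof. by rewrite /arg /= mxE castmxE /= cast_ord_id. Qed.

Lemma sum_block (V : nmodType) (f : 'I_m -> V) :
  \sum_i \sum_(q < k i) f (block q) = \sum_r f r.
Proof.
rewrite /block; move: f; case: _ / (esym e) => f.
rewrite (reindex _ (@tagnat.rank_bij_on n k)) sig_big_dep /=.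
by apply: eq_bigr => -[i q] _ /=; rewrite cast_ord_id.
Qed.

Definition base (x : 'cV[R]_d) : 'M[R]_(n, d) * 'M[R]_(d, n) :=
  (0, \matrix_(j < d, i < n) x j 0).

Definition momenta (z : B R d m) (xG : 'M[R]_(d, n)) : 'M[R]_(n, d) :=
  \matrix_(i < n) grad_x (@G i) (arg z xG i).

Definition comp_sys (z : B R d m) (y : 'M[R]_(n, d) * 'M[R]_(d, n)) : Prop :=
  y.1 = momenta z y.2 /\ y.2 = grad_p F (y.1, z.2).

Definition comp_val (z : B R d m) (y : 'M[R]_(n, d) * 'M[R]_(d, n)) : R :=
  \sum_(i < n) @G i (arg z y.2 i) + F (y.1, z.2)
  - \sum_(i < n) pairing (row i y.1) (col i y.2).

Lemma is_compE H :
  is_comp e F G H <->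
  locally_uniquely_solvable base comp_sys (fun z y => H z = comp_val z y).
Proof.
rewrite /is_comp; split=> -[W nW HW]; exists W => //.
  move=> z0 Bz0; apply: filterS (HW z0 Bz0) => z [[pF xG] [h1 h2 h3 h4]].
  exists (pF, xG); split=> //.
  by move=> [pF' xG'] h5 h6; exact: h3.
move=> z0 Bz0; apply: filterS (HW z0 Bz0) => z [[pF xG] [h1 h2 h3 h4]].
exists (pF, xG); split=> //.
by move=> [pF' xG'] h5 h6; exact: h3.
Qed.

Hypothesis gF : generating F.
Hypothesis gG : forall i, generating (@G i).

(** The system is used twice along maps into its variables that pass over the
base point: with (z, x_G) as independent variables, to set up the equation, and
along the solution, to differentiate the composite.  The maps g and X carry the
momenta and positions in both cases. *)
Section Along.
Variables (Z : normedModType R) (g : Z -> B R d m) (X : Z -> 'M[R]_(d, n)).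
Variables (z0 : Z) (x : 'cV[R]_d).
Hypothesis gz0 : g z0 = (0, x).
Hypothesis Xz0 : X z0 = (base x).2.
Hypothesis sg : smoothB g z0.
Hypothesis sX : forall a i, smooth_near (fun z => X z a i) z0.

Lemma arg_base i : arg (g z0) (X z0) i = (0, x).
Proof.
rewrite gz0 Xz0; congr (_, _); apply/matrixP => a b.
  by have := argE (0, x) (base x).2 a b; rewrite /= => ->; rewrite !mxE.
by rewrite !mxE ord1.
Qed.

Lemma smoothB_arg i : smoothB (fun z => arg (g z) (X z) i) z0.
Proof.
have [s1 _] := sg.
split=> [q a|a].
  have -> : (fun z => (arg (g z) (X z) i).1 q a) = (fun z => (g z).1 (block q) a).
    by apply/funext => z; exact: argE.
  exact: s1.
have -> : (fun z => (arg (g z) (X z) i).2 a 0) = (fun z => X z a i).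
  by apply/funext => z; rewrite mxE.
exact: sX.
Qed.

Lemma smooth_near_momenta i a : smooth_near (fun z => momenta (g z) (X z) i a) z0.
Proof.
have -> : (fun z => momenta (g z) (X z) i a) =
    (fun z => 'D_(dx (k i) a) (@G i) (arg (g z) (X z) i)).
  by apply/funext => z; rewrite mxE grad_xE.
apply: (smooth_near_compB (f := 'D_(dx (k i) a) (@G i))); last exact: smoothB_arg.
by rewrite arg_base; apply: smooth_near_derive; have [] := gG i.
Qed.

Lemma momenta_base : momenta (g z0) (X z0) = 0.
Proof.
apply/matrixP => i a; rewrite mxE grad_xE arg_base derive_dx_B0 ?mxE//.
by have [] := gG i.
Qed.

Lemma smoothB_momenta : smoothB (fun z => (momenta (g z) (X z), (g z).2)) z0.
Proof. by split=> [i a|a]; [exact: smooth_near_momenta|have [_] := sg; exact]. Qed.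

(** Second derivatives of G_i in x vanish at p = 0, so that only variations of
the momenta p_G can move p_F to first order. *)
Lemma derive_momenta v i a :
  (forall r b, 'D_v (fun z => (g z).1 r b) z0 = 0) ->
  'D_v (fun z => momenta (g z) (X z) i a) z0 = 0.
Proof.
move=> gv0.
have -> : (fun z => momenta (g z) (X z) i a) =
    (fun z => 'D_(dx (k i) a) (@G i) (arg (g z) (X z) i)).
  by apply/funext => z; rewrite mxE grad_xE.
have sdG : smooth_near ('D_(dx (k i) a) (@G i)) (arg (g z0) (X z0) i).
  by rewrite arg_base; apply: smooth_near_derive; have [] := gG i.
rewrite (derive_compB v sdG); last exact: smoothB_arg.
rewrite big1 => [|q _]; last first.
  rewrite big1// => b _.
  have -> : (fun z => (arg (g z) (X z) i).1 q b) = (fun z => (g z).1 (block q) b).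
    by apply/funext => z; exact: argE.
  by rewrite gv0 mul0r.
rewrite add0r big1// => b _; rewrite arg_base derive_dx_B0 ?mulr0// => w.
by rewrite derive_dx_B0//; have [] := gG i.
Qed.

End Along.
Lemma pairingE (p : 'rV[R]_d) (x : 'cV[R]_d) : pairing p x = \sum_a p 0 a * x a 0.
Proof. by rewrite /pairing mxE. Qed.

(** The derivative of the composite at (0, x) has three parts: the direct
variation of p_G, which gives the derivative of S_0; the variation of p_F in F,
which is D p_F . x since grad_p F(0, x) = x; and the variation of the pairing,
which is again D p_F . x and cancels the second part. *)
Lemma generating_comp_val (X : B R d m -> 'M[R]_(d, n)) :
  (forall x, X (0, x) = (base x).2) ->
  (forall x a i, smooth_near (fun z => X z a i) (0, x)) ->
  generating (fun z => comp_val z (momenta z (X z), X z)).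
Proof.
move=> X0 sX.
pose P z := momenta z (X z).
have -> : (fun z => comp_val z (P z, X z)) = (fun z =>
    \sum_i @G i (arg z (X z) i) + F (P z, z.2) - \sum_i \sum_a P z i a * X z a i).
  apply/funext => z; rewrite /comp_val; congr (_ - _); apply: eq_bigr => i _.
  by rewrite pairingE; apply: eq_bigr => a _; rewrite !mxE.
have sid x : smoothB (fun z : B R d m => z) (0, x) := smoothB_id (0, x).
have arg0 x i : arg (0, x) (X (0, x)) i = (0, x).
  exact: (arg_base (g := fun z : B R d m => z) erefl (X0 x)).
have sarg x i : smoothB (fun z => arg z (X z) i) (0, x).
  exact: smoothB_arg (sid x) (sX x) i.
have P0 x : P (0, x) = 0.
  exact: (momenta_base (g := fun z : B R d m => z) erefl (X0 x)).
have sP x i a : smooth_near (fun z => P z i a) (0, x).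
  exact: (smooth_near_momenta (g := fun z : B R d m => z) erefl (X0 x)).
have sGarg x i : smooth_near (fun z => @G i (arg z (X z) i)) (0, x).
  apply: (smooth_near_compB (f := @G i)); last exact: sarg.
  by rewrite arg0; have [] := gG i.
have sPB x : smoothB (fun z => (P z, z.2)) (0, x).
  by split=> [i a|a]; [exact: sP|have [_] := sid x; exact].
have sFP x : smooth_near (fun z => F (P z, z.2)) (0, x).
  apply: (smooth_near_compB (f := F) (g := fun z => (P z, z.2))); last exact: sPB.
  by rewrite /= P0; have [] := gF.
have sPX x i a : smooth_near (fun z => P z i a * X z a i) (0, x).
  by apply: smooth_nearM.
have sS1 x : smooth_near (fun z => \sum_i @G i (arg z (X z) i)) (0, x).
  by apply: smooth_near_sum => i; exact: sGarg.
have sS2i x i : smooth_near (fun z => \sum_a P z i a * X z a i) (0, x).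
  by apply: smooth_near_sum => a; exact: sPX.
have sS2 x : smooth_near (fun z => \sum_i \sum_a P z i a * X z a i) (0, x).
  by apply: smooth_near_sum => i; exact: sS2i.
split=> [x|x|x r b].
- by apply: smooth_nearB; [exact: smooth_nearD|].
- rewrite P0 big1 => [|i _]; last by rewrite arg0; have [] := gG i.
  have [_ -> _] := gF; rewrite add0r big1 ?subr0// => i _.
  by rewrite big1// => a _; rewrite mxE mul0r.
- have dd (f : B R d m -> R) : smooth_near f (0, x) -> derivable f (0, x) (dp r b).
    by move=> /smooth_near_diff; exact: diff_derivable.
  rewrite (@deriveB _ _ _ (fun z => \sum_i @G i (arg z (X z) i) + F (P z, z.2))
    (fun z => \sum_i \sum_a P z i a * X z a i)); [|exact/dd/smooth_nearD|exact: dd].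
  rewrite (@deriveD _ _ _ (fun z => \sum_i @G i (arg z (X z) i))
    (fun z => F (P z, z.2))); [|exact: dd|exact: dd].
  rewrite (derive_compB (f := F) (g := fun z => (P z, z.2))) //=; last first.
    by rewrite P0; have [] := gF.
  have [_ _ dF] := gF.
  under [X in _ + (X + _)]eq_bigr => i _ do under eq_bigr => a _ do rewrite P0 dF.
  rewrite [X in _ + (_ + X)]big1 => [|a _]; last first.
    by rewrite derive_z2 mxE mul0r.
  rewrite derive_sumE => [|i]; last exact/smooth_near_diff/sGarg.
  rewrite derive_sumE => [|i]; last exact/smooth_near_diff/sS2i.
  rewrite [X in _ - X](_ : _ =
      \sum_i \sum_a 'D_(dp r b) (fun z => P z i a) (0, x) * x a 0); last first.
    apply: eq_bigr => i _; rewrite derive_sumE => [|a]; last exact/smooth_near_diff.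
    apply: eq_bigr => a _.
    rewrite (@deriveM _ _ (fun z => P z i a) (fun z => X z a i)); [|exact: dd|exact: dd].
    by rewrite P0 mxE scale0r add0r X0 mxE /GRing.scale /= mulrC.
  rewrite addr0 addrK.
  transitivity (\sum_i \sum_(q < k i) (dp r b).1 (block q) b * x b 0).
    apply: eq_bigr => i _.
    rewrite (derive_compB (f := @G i)); [|by rewrite arg0; have [] := gG i|exact: sarg].
    rewrite [X in _ + X]big1 => [|a _]; last first.
      by rewrite arg0 derive_dx_B0 ?mulr0//; have [] := gG i.
    rewrite addr0; apply: eq_bigr => q _.
    have [_ _ dG] := gG i; rewrite arg0.
    have E a : (fun z => (arg z (X z) i).1 q a) = (fun z => z.1 (block q) a).
      by apply/funext => z; exact: argE.
    under eq_bigr => a _ do rewrite E derive_z1 dG.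
    by rewrite (bigD1 b)//= big1 ?addr0// => a ab; rewrite !mxE (negPf ab) andbF mul0r.
  rewrite (sum_block (fun c => (dp r b).1 c b * x b 0)) (bigD1 r)//= big1.
    by rewrite !mxE !eqxx mul1r addr0.
  by move=> c cr; rewrite !mxE (negPf cr) mul0r.
Qed.

(** Beyond unique solvability, the solution y tends to the base point, which the
mere existence of a uniqueness domain W would not imply. *)
Theorem comp_solution :
  exists (W : set (B R d m * ('M[R]_(n, d) * 'M[R]_(d, n))))
      (y : B R d m -> 'M[R]_(n, d) * 'M[R]_(d, n)),
  [/\ forall x, nbhs ((0, x), base x) W,
      forall x, y z @[z --> ((0, x) : B R d m)] --> base x,
      generating (fun z => comp_val z (y z)) &
      forall x, \forall z \near ((0, x) : B R d m),
        [/\ W (z, y z), comp_sys z (y z) &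
            forall y', W (z, y') -> comp_sys z y' -> y' = y z]].
Proof.
pose N := (d * n)%N.
pose rhs (p : B R d m * 'rV[R]_N) : 'M[R]_(d, n) :=
  grad_p F (momenta p.1 (vec_mx p.2), p.1.2).
pose Psi (c : 'I_N) p := mxvec (rhs p) 0 c.
pose b (z : B R d m) : 'rV[R]_N := mxvec (base z.2).2.
have bE z : vec_mx (b z) = (base z.2).2 by rewrite mxvecK.
have solvesE z u : solves Psi z u <-> vec_mx u = rhs (z, u).
  split=> [su|Eu c]; last by rewrite /Psi -Eu vec_mxK.
  by apply: (can_inj mxvecK); rewrite vec_mxK; apply/rowP => c; exact: su.
have g0 x : ((0, x), b (0, x)).1 = (0, x) :> B R d m by [].
have X0 x : vec_mx ((0, x) : B R d m, b (0, x)).2 = (base x).2 by rewrite bE.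
have sg q : smoothB (fun p : B R d m * 'rV[R]_N => p.1) q.
  split=> [i a|a].
    apply: (@smooth_near_linear _ _ (@mx_coord R m d i a \o (fst \o fst))) => w.
    apply: continuous_comp; last exact: coord_continuous.
    by apply: continuous_comp; exact: cvg_fst.
  apply: (@smooth_near_linear _ _ (@mx_coord R d 1 a 0 \o (snd \o fst))) => w.
  apply: continuous_comp; last exact: coord_continuous.
  by apply: continuous_comp; [exact: cvg_fst|exact: cvg_snd].
have XE a i : (fun p : B R d m * 'rV[R]_N => vec_mx p.2 a i) =
    @mx_coord R 1 N 0 (mxvec_index a i) \o snd.
  by apply/funext => p; rewrite mxE.
have cX a i : continuous (@mx_coord R 1 N 0 (mxvec_index a i) \o
    (snd : B R d m * 'rV[R]_N -> _)).
  by move=> w; apply: continuous_comp; [exact: cvg_snd|exact: coord_continuous].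
have sX q a i : smooth_near (fun p : B R d m * 'rV[R]_N => vec_mx p.2 a i) q.
  rewrite XE.
  apply: (@smooth_near_linear _ _ (@mx_coord R 1 N 0 (mxvec_index a i) \o snd)).
  exact: cX.
have PsiE a i : Psi (mxvec_index a i) = (fun p =>
    'D_(dp i a) F (momenta p.1 (vec_mx p.2), p.1.2)).
  by apply/funext => p; rewrite /Psi mxvecE grad_pE.
have sPB x : smoothB (fun p : B R d m * 'rV[R]_N =>
    (momenta p.1 (vec_mx p.2), p.1.2)) ((0, x), b (0, x)).
  exact: (smoothB_momenta (g := fst) (X := fun p => vec_mx p.2) (g0 x) (X0 x)).
have P0 x : momenta (0, x) (vec_mx (b (0, x))) = 0.
  exact: (momenta_base (g := fst) (X := fun p => vec_mx p.2) (g0 x) (X0 x)).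
have D1 (v : B R d m * 'rV[R]_N) q r c :
    'D_v (fun p : B R d m * 'rV[R]_N => p.1.1 r c) q = v.1.1 r c.
  apply: (@derive_linear _ _ (@mx_coord R m d r c \o (fst \o fst))) => w.
  apply: continuous_comp; last exact: coord_continuous.
  by apply: continuous_comp; exact: cvg_fst.
have D2 (v : B R d m * 'rV[R]_N) q c :
    'D_v (fun p : B R d m * 'rV[R]_N => p.1.2 c 0) q = v.1.2 c 0.
  apply: (@derive_linear _ _ (@mx_coord R d 1 c 0 \o (snd \o fst))) => w.
  apply: continuous_comp; last exact: coord_continuous.
  by apply: continuous_comp; [exact: cvg_fst|exact: cvg_snd].
have B0E (z : B R d m) : B0 z -> z = (0, z.2).
  by case: z => p x p0; have -> : p = 0 := p0.
have sF2 x a i : smooth_near ('D_(dp i a) F) (0, x).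
  by apply: smooth_near_derive; have [] := gF.
have [|||| W [y [nW yb sy Wy]]] := @implicit_solution R _ N (@B0 R d m) b Psi.
- move=> z _; apply: cvg_mx => i c; case/mxvec_indexP: c => a j; rewrite ord1.
  have E (w : B R d m) : b w 0 (mxvec_index a j) = w.2 a 0.
    by rewrite mxvecE mxE.
  under eq_cvg do rewrite E.
  rewrite E; apply: (cvg_coord (f := snd)); exact: cvg_snd.
- move=> z c /B0E ->; case/mxvec_indexP: c => a i; rewrite PsiE.
  apply: (smooth_near_compB (f := 'D_(dp i a) F)
    (g := fun p => (momenta p.1 (vec_mx p.2), p.1.2))) => /=; last exact: sPB.
  by rewrite P0.
- move=> z c /B0E ->; case/mxvec_indexP: c => a i; rewrite PsiE /= P0 mxvecE mxE.
  by have [_ _ ->] := gF.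
- move=> z l c /B0E ->; case/mxvec_indexP: c => a i; rewrite PsiE.
  rewrite (derive_compB (f := 'D_(dp i a) F)
    (g := fun p => (momenta p.1 (vec_mx p.2), p.1.2))) /=; [|by rewrite P0|exact: sPB].
  rewrite big1 => [|j _]; last first.
    rewrite big1// => e' _.
    rewrite (derive_momenta (g := fst) (X := fun p => vec_mx p.2)
      (g0 z.2) (X0 z.2) (sg _) (sX _)) ?mul0r// => r c.
    by rewrite D1 mxE.
  by rewrite add0r big1// => c _; rewrite D2 mxE mul0r.
pose X z : 'M[R]_(d, n) := vec_mx (y z).
have Xb x : X (0, x) = (base x).2 by rewrite /X yb// bE.
have sXy x a i : smooth_near (fun z => X z a i) (0, x).
  have -> : (fun z => X z a i) = (fun z => y z 0 (mxvec_index a i)).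
    by apply/funext => z; rewrite mxE.
  exact: sy.
exists [set p | W (p.1, mxvec p.2.2)], (fun z => (momenta z (X z), X z)); split.
- move=> x.
  have cp : (p.1, mxvec p.2.2) @[p --> ((0, x) : B R d m, base x)] --> ((0, x), b (0, x)).
    apply: pair_cvg; first exact: cvg_fst.
    apply: cvg_mx => i c; rewrite ord1; case/mxvec_indexP: c => a j.
    rewrite mxvecE; under eq_cvg do rewrite mxvecE.
    apply: (cvg_coord (f := fun p : B R d m * ('M[R]_(n, d) * 'M[R]_(d, n)) => p.2.2)).
    exact: (cvg_comp _ _ cvg_snd cvg_snd).
  exact: cp (nW (0, x) _).
- move=> x; apply: pair_cvg; apply: cvg_mx => i a.
  + apply: smooth_near_cvg; last first.
      exact: (smooth_near_momenta (g := id) erefl (Xb x) (smoothB_id _) (sXy x) i a).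
    have M0 : momenta (0, x) (X (0, x)) = 0.
      exact: (momenta_base (g := id) erefl (Xb x)).
    by rewrite /= M0.
  + by apply: smooth_near_cvg; [rewrite Xb|exact: sXy].
- exact: generating_comp_val.
- move=> x; have Bx : @B0 R d m (0, x) by [].
  apply: filterS (Wy _ Bx) => z [Wz sz uz]; split.
  + by rewrite /= vec_mxK.
  + by split=> //=; rewrite /X; have /solvesE := sz.
  + move=> [pF xG] /= Wz' [/= EP EX]; have Exy : mxvec xG = y z.
      apply: uz; first exact: Wz'.
      apply: (proj2 (solvesE _ _)); rewrite mxvecK [LHS]EX /rhs [RHS]/=.
      by rewrite mxvecK EP.
    by rewrite /X -Exy mxvecK EP.
Qed.

End Composition.

End Generating.

(** * The two compositions of degrees (1,2) and (2,1) *)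

Section Degree2.
Context {R : realType}.
Variable d : nat.

Lemma sum_ord2 (V : nmodType) (f : 'I_2 -> V) : \sum_i f i = f 0 + f 1.
Proof.
rewrite !big_ord_recl big_ord0 addr0; congr (f _ + f _); exact: val_inj.
Qed.

Lemma ord2P (P : 'I_2 -> Prop) : P 0 -> P 1 -> forall i, P i.
Proof.
move=> P0 P1 [[|[|//]] h].
  by rewrite (_ : Ordinal h = 0)//; exact: val_inj.
by rewrite (_ : Ordinal h = 1)//; exact: val_inj.
Qed.

Lemma pt2_row (p : 'M[R]_(2, d)) (x : 'cV[R]_d) : (p, x) = pt2 (row 0 p) (row 1 p) x.
Proof.
congr (_, _); apply/matrixP => i a; rewrite [RHS]mxE.
by case: splitP => j ij; rewrite mxE; congr (p _ a); apply: val_inj; rewrite /= ij ord1.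
Qed.

Lemma row0_col_mx (p q : 'rV[R]_d) : row 0 (col_mx p q : 'M[R]_(2, d)) = p.
Proof. by apply/rowP => a; rewrite !mxE; case: splitP => // j _; rewrite ord1. Qed.

Lemma row1_col_mx (p q : 'rV[R]_d) : row 1 (col_mx p q : 'M[R]_(2, d)) = q.
Proof.
by apply/rowP => a; rewrite !mxE; case: splitP => [[[]]|] // j _; rewrite ord1.
Qed.

Lemma col0_row_mx (p q : 'cV[R]_d) : col 0 (row_mx p q : 'M[R]_(d, 2)) = p.
Proof. by apply/colP => a; rewrite !mxE; case: splitP => // j _; rewrite ord1. Qed.

Lemma col1_row_mx (p q : 'cV[R]_d) : col 1 (row_mx p q : 'M[R]_(d, 2)) = q.
Proof.
by apply/colP => a; rewrite !mxE; case: splitP => [[[]]|] // j _; rewrite ord1.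
Qed.

Lemma eq_row2 (p q : 'M[R]_(2, d)) : row 0 p = row 0 q -> row 1 p = row 1 q -> p = q.
Proof. by move=> h0 h1; apply/row_matrixP; exact: ord2P. Qed.

Lemma eq_col2 (p q : 'M[R]_(d, 2)) : col 0 p = col 0 q -> col 1 p = col 1 q -> p = q.
Proof.
move=> h0 h1; apply/matrixP => a; apply: ord2P.
  by have /colP/(_ a) := h0; rewrite !mxE.
by have /colP/(_ a) := h1; rewrite !mxE.
Qed.

Section Args.
Variables (z : B R d 3) (xG : 'M[R]_(d, 2)).

Lemma arg12_0 : arg (deg2_sum 1 2) z xG 0 = ((row 0 z.1, col 0 xG) : B R d 1).
Proof.
congr (_, _); apply/matrixP => q a.
rewrite mxE castmxE cast_ord_id [RHS]mxE; congr (z.1 _ a); apply: val_inj.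
rewrite [LHS](@tagnat.RankEsum 2 _ _ q) big1 => [|[[|[|//]] h]]//.
by case: q => -[].
Qed.

Lemma arg12_1 :
  arg (deg2_sum 1 2) z xG 1 = pt2 (row 1 z.1) (row 2%:R z.1) (col 1 xG).
Proof.
congr (_, _); apply/matrixP => q a.
rewrite mxE castmxE cast_ord_id [RHS]mxE.
case: splitP => j qj; rewrite mxE; congr (z.1 _ a); apply: val_inj;
  rewrite [LHS](@tagnat.RankEsum 2 _ _ q) (big_pred1 0) /= ?qj ?ord1//;
  by move=> [[|[|//]] h].
Qed.

Lemma arg21_0 :
  arg (deg2_sum 2 1) z xG 0 = pt2 (row 0 z.1) (row 1 z.1) (col 0 xG).
Proof.
congr (_, _); apply/matrixP => q a.
rewrite mxE castmxE cast_ord_id [RHS]mxE.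
case: splitP => j qj; rewrite mxE; congr (z.1 _ a); apply: val_inj;
  rewrite [LHS](@tagnat.RankEsum 2 _ _ q) big1 /= ?qj ?ord1//;
  by move=> [[|[|//]] h].
Qed.

Lemma arg21_1 : arg (deg2_sum 2 1) z xG 1 = ((row 2%:R z.1, col 1 xG) : B R d 1).
Proof.
congr (_, _); apply/matrixP => q a.
rewrite mxE castmxE cast_ord_id [RHS]mxE; congr (z.1 _ a); apply: val_inj.
rewrite [LHS](@tagnat.RankEsum 2 _ _ q) (big_pred1 0) /=; first by case: q => -[].
by move=> [[|[|//]] h].
Qed.

End Args.

Lemma gen_unit (p : 'rV[R]_d) x : gen_fun (Oloc_unit R d) (p, x) = pairing p x.
Proof.
rewrite /gen_fun addr0 /S0 big_ord_recl big_ord0 addr0 /=; congr (pairing _ x).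
by apply/rowP => a; rewrite mxE.
Qed.

Lemma grad_x_unit (p : 'rV[R]_d) x : grad_x (gen_fun (Oloc_unit R d)) (p, x) = p.
Proof.
have -> : gen_fun (Oloc_unit R d) = @S0 R d 1.
  by apply/funext => z; rewrite /gen_fun addr0.
apply/rowP => a; rewrite grad_xE derive_S0 big_ord_recl big_ord0 addr0.
rewrite (bigD1 a)//= big1 => [|b ba]; last by rewrite !mxE (negPf ba) mulr0 mul0r addr0.
by rewrite !mxE !eqxx mul0r mulr1 add0r addr0.
Qed.

End Degree2.

(** * Products and the associativity equation *)

Section Product.
Context {R : realType}.
Variables (d : nat) (S : Oloc R d 2).

Notation Sg := (gen_fun S).

Definition factors12 (i : 'I_2) := gen_fun (@args2 (Oloc R d) 1 2 (Oloc_unit R d) S i).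
Definition factors21 (i : 'I_2) := gen_fun (@args2 (Oloc R d) 2 1 S (Oloc_unit R d) i).

Lemma comp12_sysP z pF xG :
  comp_sys (deg2_sum 1 2) Sg factors12 z (pF, xG) <->
  [/\ row 0 pF = row 0 z.1,
      row 1 pF = grad_x Sg (pt2 (row 1 z.1) (row 2%:R z.1) (col 1 xG)) &
      xG = grad_p Sg (pt2 (row 0 pF) (row 1 pF) z.2)].
Proof.
have m0 : row 0 (momenta (deg2_sum 1 2) factors12 z xG) = row 0 z.1.
  by rewrite rowK arg12_0; exact: grad_x_unit.
have m1 : row 1 (momenta (deg2_sum 1 2) factors12 z xG) =
    grad_x Sg (pt2 (row 1 z.1) (row 2%:R z.1) (col 1 xG)).
  by rewrite rowK arg12_1.
rewrite -(pt2_row pF z.2) -m0 -m1; split=> [[/= Ep Ex]|[h0 h1 h2]].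
  by rewrite -Ep.
by split; [exact: eq_row2|exact: h2].
Qed.

Lemma comp21_sysP z pF xG :
  comp_sys (deg2_sum 2 1) Sg factors21 z (pF, xG) <->
  [/\ row 0 pF = grad_x Sg (pt2 (row 0 z.1) (row 1 z.1) (col 0 xG)),
      row 1 pF = row 2%:R z.1 &
      xG = grad_p Sg (pt2 (row 0 pF) (row 1 pF) z.2)].
Proof.
have m0 : row 0 (momenta (deg2_sum 2 1) factors21 z xG) =
    grad_x Sg (pt2 (row 0 z.1) (row 1 z.1) (col 0 xG)).
  by rewrite rowK arg21_0.
have m1 : row 1 (momenta (deg2_sum 2 1) factors21 z xG) = row 2%:R z.1.
  by rewrite rowK arg21_1; exact: grad_x_unit.
rewrite -(pt2_row pF z.2) -m0 -m1; split=> [[/= Ep Ex]|[h0 h1 h2]].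
  by rewrite -Ep.
by split; [exact: eq_row2|exact: h2].
Qed.

Lemma comp12_valE z pF xG : row 0 pF = row 0 z.1 ->
  comp_val (deg2_sum 1 2) Sg factors12 z (pF, xG) =
  Sg (pt2 (row 1 z.1) (row 2%:R z.1) (col 1 xG)) +
  Sg (pt2 (row 0 z.1) (row 1 pF) z.2) - pairing (row 1 pF) (col 1 xG).
Proof.
move=> p0; rewrite /comp_val !sum_ord2 /= arg12_0 arg12_1 (pt2_row pF) p0.
by rewrite [@factors12 0 _]gen_unit /factors12 /=; ring.
Qed.

Lemma comp21_valE z pF xG : row 1 pF = row 2%:R z.1 ->
  comp_val (deg2_sum 2 1) Sg factors21 z (pF, xG) =
  Sg (pt2 (row 0 z.1) (row 1 z.1) (col 0 xG)) +
  Sg (pt2 (row 0 pF) (row 2%:R z.1) z.2) - pairing (row 0 pF) (col 0 xG).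
Proof.
move=> p0; rewrite /comp_val !sum_ord2 /= arg21_0 arg21_1 (pt2_row pF) p0.
by rewrite [@factors21 1 _]gen_unit /factors21 /=; ring.
Qed.

Lemma Oloc_productE : Oloc_product S <-> exists T : Oloc R d 3,
  is_comp (deg2_sum 1 2) Sg factors12 (gen_fun T) /\
  is_comp (deg2_sum 2 1) Sg factors21 (gen_fun T).
Proof. by []. Qed.

Section GradientLimit.
Context {T : Type} {FT : set_system T} {FF : Filter FT}.

Lemma cvg_grad_p (f g : T -> 'rV[R]_d) (h : T -> 'cV[R]_d) (x : 'cV[R]_d) i :
  f t @[t --> FT] --> (0 : 'rV[R]_d) -> g t @[t --> FT] --> (0 : 'rV[R]_d) ->
  h t @[t --> FT] --> x ->
  col i (grad_p Sg (pt2 (f t) (g t) (h t))) @[t --> FT] --> x.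
Proof.
move=> f0 g0 hx.
have lim : pt2 (f t) (g t) (h t) @[t --> FT] --> ((0, x) : B R d 2).
  apply: pair_cvg => //.
  have : col_mx (f t) (g t) @[t --> FT] -->
      col_mx (0 : 'rV[R]_d) (0 : 'rV[R]_d) by exact: cvg_col_mx.
  by rewrite col_mx0.
have [sS _ dS] := generating_gen_fun S.
apply: cvg_mx => a j; under eq_cvg do rewrite mxE grad_pE.
rewrite (ord1 j).
apply: (cvg_comp _ ('D_(dp i a) Sg) lim); apply: smooth_near_cvg; first exact: dS.
exact: smooth_near_derive.
Qed.
End GradientLimit.

(** y1 and y2 complete an unknown of the associativity system to unknowns of the
two composition systems, by the components that those systems determine
explicitly. *)
Lemma product_SGA : Oloc_product S -> SGA Sg.
Proof.
move=> /Oloc_productE[T [/is_compE[W1 nW1 H1] /is_compE[W2 nW2 H2]]].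
pose Y := ('cV[R]_d * 'rV[R]_d * 'cV[R]_d * 'rV[R]_d)%type.
pose y1 (z : B R d 3) (y : Y) : 'M[R]_(2, d) * 'M[R]_(d, 2) :=
  (col_mx (row 0 z.1) y.2,
   row_mx (col 0 (grad_p Sg (pt2 (row 0 z.1) y.2 z.2))) y.1.2).
pose y2 (z : B R d 3) (y : Y) : 'M[R]_(2, d) * 'M[R]_(d, 2) :=
  (col_mx y.1.1.2 (row 2%:R z.1),
   row_mx y.1.1.1 (col 1 (grad_p Sg (pt2 y.1.1.2 (row 2%:R z.1) z.2)))).
exists [set p | W1 (p.1, y1 p.1 p.2) /\ W2 (p.1, y2 p.1 p.2)].
  move=> _ [x _ <-].
  have l1 : row_mx x x = (base 2 x).2 :> 'M[R]_(d, 2).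
    by apply/matrixP => a i; rewrite !mxE; case: splitP => j _; rewrite ord1.
  pose b0 : B R d 3 * Y := ((0, x), (x, 0, x, 0)).
  have cz i : row i p.1.1 @[p --> b0] --> (0 : 'rV[R]_d).
    by rewrite -(row0 _ d i); apply: cvg_row; exact: (cvg_comp _ _ cvg_fst cvg_fst).
  have cx : p.1.2 @[p --> b0] --> x by exact: (cvg_comp _ _ cvg_fst cvg_snd).
  have cxb : p.2.1.1.1 @[p --> b0] --> x.
    exact: (cvg_comp _ _ (cvg_comp _ _ (cvg_comp _ _ cvg_snd cvg_fst) cvg_fst) cvg_fst).
  have cpb : p.2.1.1.2 @[p --> b0] --> (0 : 'rV[R]_d).
    exact: (cvg_comp _ _ (cvg_comp _ _ (cvg_comp _ _ cvg_snd cvg_fst) cvg_fst) cvg_snd).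
  have cxt : p.2.1.2 @[p --> b0] --> x.
    exact: (cvg_comp _ _ (cvg_comp _ _ cvg_snd cvg_fst) cvg_snd).
  have cpt : p.2.2 @[p --> b0] --> (0 : 'rV[R]_d).
    exact: (cvg_comp _ _ cvg_snd cvg_snd).
  have c1 : (p.1, y1 p.1 p.2) @[p --> b0] --> ((0, x), base 2 x).
    apply: pair_cvg; first exact: cvg_fst.
    rewrite [base 2 x]surjective_pairing -l1 /= -[0 in X in _ --> X](@col_mx0 _ 1 1 d).
    apply: pair_cvg; first exact: (@cvg_col_mx R _ _ _ 1 1 d).
    by apply: (@cvg_row_mx R _ _ _ d 1 1) => //; exact: cvg_grad_p.
  have c2 : (p.1, y2 p.1 p.2) @[p --> b0] --> ((0, x), base 2 x).
    apply: pair_cvg; first exact: cvg_fst.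
    rewrite [base 2 x]surjective_pairing -l1 /= -[0 in X in _ --> X](@col_mx0 _ 1 1 d).
    apply: pair_cvg; first exact: (@cvg_col_mx R _ _ _ 1 1 d).
    by apply: (@cvg_row_mx R _ _ _ d 1 1) => //; exact: cvg_grad_p.
  apply: filterI.
    by apply: c1; apply: nW1; exists x.
  by apply: c2; apply: nW2; exists x.
move=> z0 Bz0; apply: filterS (filterI (H1 z0 Bz0) (H2 z0 Bz0)).
move=> z [[[pF1 xG1] [w1 /comp12_sysP[a0 a1 a2] u1 v1]]
          [[pF2 xG2] [w2 /comp21_sysP[b0 b1 b2] u2 v2]]].
have {}a2 : xG1 = grad_p Sg (pt2 (row 0 z.1) (row 1 pF1) z.2) by rewrite -a0.
have {}b2 : xG2 = grad_p Sg (pt2 (row 0 pF2) (row 2%:R z.1) z.2) by rewrite -b1.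
have E1 : y1 z (col 0 xG2, row 0 pF2, col 1 xG1, row 1 pF1) = (pF1, xG1).
  congr (_, _) => /=.
    by apply: eq_row2; [rewrite row0_col_mx a0|rewrite row1_col_mx].
  by apply: eq_col2; [rewrite col0_row_mx a2|rewrite col1_row_mx].
have E2 : y2 z (col 0 xG2, row 0 pF2, col 1 xG1, row 1 pF1) = (pF2, xG2).
  congr (_, _) => /=.
    by apply: eq_row2; [rewrite row0_col_mx|rewrite row1_col_mx b1].
  by apply: eq_col2; [rewrite col0_row_mx|rewrite col1_row_mx b2].
exists (col 0 xG2, row 0 pF2, col 1 xG1, row 1 pF1); split.
- by rewrite /= E1 E2.
- by split=> //=; [rewrite {1}b2|rewrite {1}a2].
- move=> [[[xb pb] xt] pt] [/= w1' w2'] [e1 e2 e3 e4].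
  have s1 : comp_sys (deg2_sum 1 2) Sg factors12 z (y1 z (xb, pb, xt, pt)).
    apply/comp12_sysP; rewrite row0_col_mx row1_col_mx col1_row_mx /=; split=> //.
    by apply: eq_col2; rewrite (col0_row_mx, col1_row_mx).
  have s2 : comp_sys (deg2_sum 2 1) Sg factors21 z (y2 z (xb, pb, xt, pt)).
    apply/comp21_sysP; rewrite row0_col_mx row1_col_mx col0_row_mx /=; split=> //.
    by apply: eq_col2; rewrite (col0_row_mx, col1_row_mx).
  have [<- <-] := u1 _ w1' s1; have [<- <-] := u2 _ w2' s2.
  by rewrite row0_col_mx row1_col_mx col0_row_mx col1_row_mx.
- move: v1 v2; rewrite comp12_valE// comp21_valE// => v1 v2.
  exact: etrans (esym v2) v1.
Qed.

(** The juxtaposition y of the two solutions tends to (x, 0, x, 0), hence lies in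
the uniqueness domain W near B0 and satisfies the associativity equation; the
two values then agree, and the first one represents both compositions. *)
Lemma SGA_product : SGA Sg -> Oloc_product S.
Proof.
move=> [W nW HW].
have gS : generating Sg := generating_gen_fun S.
have gG12 i : generating (@factors12 i) := generating_gen_fun _.
have gG21 i : generating (@factors21 i) := generating_gen_fun _.
have [W1 [Y1 [nW1 cY1 gH1 HY1]]] := comp_solution (m := 3) (deg2_sum 1 2) gS gG12.
have [W2 [Y2 [nW2 cY2 gH2 HY2]]] := comp_solution (m := 3) (deg2_sum 2 1) gS gG21.
pose y z : 'cV[R]_d * 'rV[R]_d * 'cV[R]_d * 'rV[R]_d :=
  (col 0 (Y2 z).2, row 0 (Y2 z).1, col 1 (Y1 z).2, row 1 (Y1 z).1).
have col_base (x : 'cV[R]_d) i : col i (base 2 x).2 = x.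
  by apply/colP => a; rewrite !mxE.
have B0E (z : B R d 3) : B0 z -> z = (0, z.2).
  by case: z => p x p0; have -> : p = 0 := p0.
have H12 x : \forall z \near ((0, x) : B R d 3),
    comp_val (deg2_sum 2 1) Sg factors21 z (Y2 z) =
    comp_val (deg2_sum 1 2) Sg factors12 z (Y1 z).
  have cy : y z @[z --> ((0, x) : B R d 3)] --> (x, 0, x, 0).
    have c1 := cY1 x; have c2 := cY2 x.
    have X1 : (Y1 z).2 @[z --> ((0, x) : B R d 3)] --> (base 2 x).2.
      exact: (cvg_comp _ _ c1 cvg_snd).
    have P1 : (Y1 z).1 @[z --> ((0, x) : B R d 3)] --> (0 : 'M[R]_(2, d)).
      exact: (cvg_comp _ _ c1 cvg_fst).
    have X2 : (Y2 z).2 @[z --> ((0, x) : B R d 3)] --> (base 2 x).2.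
      exact: (cvg_comp _ _ c2 cvg_snd).
    have P2 : (Y2 z).1 @[z --> ((0, x) : B R d 3)] --> (0 : 'M[R]_(2, d)).
      exact: (cvg_comp _ _ c2 cvg_fst).
    have col2 : col 0 (Y2 z).2 @[z --> ((0, x) : B R d 3)] --> x.
      have : col 0 (Y2 z).2 @[z --> ((0, x) : B R d 3)] --> col 0 (base 2 x).2.
        exact: cvg_col.
      by rewrite col_base.
    have row2 : row 0 (Y2 z).1 @[z --> ((0, x) : B R d 3)] --> (0 : 'rV[R]_d).
      have : row 0 (Y2 z).1 @[z --> ((0, x) : B R d 3)]
          --> row 0 (0 : 'M[R]_(2, d)) by exact: cvg_row.
      by rewrite row0.
    have col1 : col 1 (Y1 z).2 @[z --> ((0, x) : B R d 3)] --> x.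
      have : col 1 (Y1 z).2 @[z --> ((0, x) : B R d 3)] --> col 1 (base 2 x).2.
        exact: cvg_col.
      by rewrite col_base.
    have row1 : row 1 (Y1 z).1 @[z --> ((0, x) : B R d 3)] --> (0 : 'rV[R]_d).
      have : row 1 (Y1 z).1 @[z --> ((0, x) : B R d 3)]
          --> row 1 (0 : 'M[R]_(2, d)) by exact: cvg_row.
      by rewrite row0.
    by do 3?apply: pair_cvg.
  have Wy : \forall z \near ((0, x) : B R d 3), W (z, y z).
    have cz : (z, y z) @[z --> ((0, x) : B R d 3)] --> ((0, x), (x, 0, x, 0)).
      by apply: pair_cvg => //; exact: cvg_id.
    by apply: cz; apply: nW; exists x.
  have Bx : @B0 R d 3 (0, x) by [].
  apply: filterS (filterI Wy (filterI (HW _ Bx) (filterI (HY1 x) (HY2 x)))).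
  move=> z [Wz [[y' [_ _ uy' vy']] [[_ s1 _] [_ s2 _]]]].
  move: s1 s2 (erefl (y z)); rewrite {1}/y.
  case: (Y1 z) (Y2 z) => [pF1 xG1] [pF2 xG2].
  move=> /comp12_sysP[a0 a1 a2] /comp21_sysP[b0 b1 b2] /= yz.
  have {}a2 : xG1 = grad_p Sg (pt2 (row 0 z.1) (row 1 pF1) z.2) by rewrite -a0.
  have {}b2 : xG2 = grad_p Sg (pt2 (row 0 pF2) (row 2%:R z.1) z.2) by rewrite -b1.
  rewrite comp12_valE// comp21_valE//.
  move: vy'; rewrite -(uy' _ Wz) -yz//.
  by split=> //=; [rewrite {1}b2|rewrite {1}a2].
have [T TE] := generating_Oloc gH1.
apply/Oloc_productE; exists T; rewrite TE; split; apply/is_compE.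
  exists W1; first by move=> _ [x _ <-]; exact: nW1.
  move=> z0 /B0E ->; apply: filterS (HY1 z0.2) => z [h1 h2 h3].
  by exists (Y1 z); split=> // y' w' s'; exact: h3.
exists W2; first by move=> _ [x _ <-]; exact: nW2.
move=> z0 /B0E ->.
apply: filterS (filterI (HY2 z0.2) (H12 z0.2)) => z [[h1 h2 h3] h4].
by exists (Y2 z); split=> // y' w' s'; exact: h3.
Qed.

End Product.

Theorem proposition6 (R : realType) (d : nat) (hd : (1 <= d)%N) (S : Oloc R d 2) :
  Oloc_product S <-> SGA (gen_fun S).
Proof. by split; [exact: product_SGA|exact: SGA_product]. Qed.
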